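(* There is an algorithm that, given a set $\mathcal{R}$ of rules on a finite ground set $Q$, computes the set of all critical rules of the antimatroid $\mathcal{A}(\mathcal{R})$ in time $O(l(\mathcal{R})^2)$.
   Context: A rule on $Q$ is a pair $(A,q)$ with $A\subseteq Q$, $q\in Q$; it accepts $X\subseteq Q$ if $q\in X$ implies $X\cap A\neq\emptyset$. For a set $\mathcal{R}$ of rules, $\mathcal{K}(\mathcal{R})$ is the family of subsets of $Q$ accepted by all rules in $\mathcal{R}$. A tight path from $\emptyset$ to $X$ in a family $\mathcal{K}$ is a sequence $\emptyset=Y_0\subseteq\dots\subseteq Y_k=X$ of members of $\mathcal{K}$ with $|Y_{i+1}\setminus Y_i|=1$. $\mathcal{A}(\mathcal{R})$ is the family of $K\in\mathcal{K}(\mathcal{R})$ such that there is a tight path from $\emptyset$ to $K$ in $\mathcal{K}(\mathcal{R})$; it is an antimatroid (union-closed, and every nonempty member $X$ has $x\in X$ with $X\setminus\{x\}$ a member). For an antimatroid $\mathcal{A}$ on $Q$, let $\mathcal{A}^*=\{Q\setminus X: X\in\mathcal{A}\}$ and let $\tau(X)=\bigcap\{Y\in\mathcal{A}^*: X\subseteq Y\}$ be its closure operator. A rule $(A,q)$ with $q\notin A$ is critical for $\mathcal{A}$ if, writing $C=A\cup\{q\}$, one has $\tau(C)\setminus\{q\}\notin\mathcal{A}^*$ and $\tau(C)\setminus\{q,s\}\in\mathcal{A}^*$ for every $s\in A$. The input size is $l(\mathcal{R})=\sum_{(A,q)\in\mathcal{R}}(|A|+1)$. *)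

(* Defs.v *)
From mathcomp Require Import all_boot.
Set Implicit Arguments.
Unset Strict Implicit.
Unset Printing Implicit Defensive.

Section Antimatroid.
Variable n : nat.
Notation Q := 'I_n.

Definition rule := ({set Q} * Q)%type.

Definition accepts (r : rule) (X : {set Q}) : bool :=
  (r.2 \in X) ==> (X :&: r.1 != set0).

Definition Kfam (R : {set rule}) : {set {set Q}} :=
  [set X | [forall r in R, accepts r X]].

Definition tight_step (K : {set {set Q}}) : rel {set Q} :=
  fun Y Z => [&& Y \in K, Z \in K, Y \subset Z & #|Z :\: Y| == 1].

Definition Afam (R : {set rule}) : {set {set Q}} :=
  [set X in Kfam R | connect (tight_step (Kfam R)) set0 X].

Definition dualfam (F : {set {set Q}}) : {set {set Q}} :=
  [set ~: X | X in F].

Definition tau (F : {set {set Q}}) (X : {set Q}) : {set Q} :=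
  \bigcap_(Y in dualfam F | X \subset Y) Y.

Definition critical (F : {set {set Q}}) (r : rule) : bool :=
  let A := r.1 in let q := r.2 in
  let tC := tau F (q |: A) in
  [&& q \notin A,
      (tC :\ q) \notin dualfam F
    & [forall s in A, (tC :\ q :\ s) \in dualfam F]].

Definition critical_rules (F : {set {set Q}}) : {set rule} :=
  [set r | critical F r].

Definition lsize (R : {set rule}) : nat := \sum_(r in R) (#|r.1| + 1).

Definition rule_of (x : seq Q * Q) : rule := ([set a in x.1], x.2).
Definition set_of_rules (rs : seq (seq Q * Q)) : {set rule} :=
  [set r | r \in map rule_of rs].
Definition wf_rules (rs : seq (seq Q * Q)) : bool :=
  all (fun x => uniq x.1) rs && uniq (map rule_of rs).

Definition enc_rule (x : seq Q * Q) : seq nat :=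
  [:: val x.2, size x.1 & map val x.1].
Definition enc_rules (rs : seq (seq Q * Q)) : seq nat :=
  size rs :: flatten (map enc_rule rs).
Definition enc_input (rs : seq (seq Q * Q)) : seq nat := n :: enc_rules rs.

Definition represents (o : seq nat) (S : {set rule}) : Prop :=
  exists rs : seq (seq Q * Q),
    [/\ o = enc_rules rs, wf_rules rs & set_of_rules rs = S].
End Antimatroid.

(* Machine model: unit-cost random access machine (RAM).               *)

Inductive instr : Type :=
| IConst of nat & nat
| IAdd of nat & nat & nat
| ISub of nat & nat & nat
| ILoad of nat & nat
| IStore of nat & nat
| IJz of nat & nat
| IJmp of nat
| IHalt.

Definition program := seq instr.

Record config := Config { pc : nat; mem : nat -> nat }.

Definition upd (m : nat -> nat) (a v : nat) : nat -> nat :=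
  fun x => if x == a then v else m x.

Definition fetch (p : program) (i : nat) : instr := nth IHalt p i.

Definition is_halted (p : program) (c : config) : bool :=
  if fetch p (pc c) is IHalt then true else false.

Definition step (p : program) (c : config) : config :=
  let m := mem c in
  match fetch p (pc c) with
  | IConst d k => Config (pc c).+1 (upd m d k)
  | IAdd d a b => Config (pc c).+1 (upd m d (m a + m b))
  | ISub d a b => Config (pc c).+1 (upd m d (m a - m b))
  | ILoad d a => Config (pc c).+1 (upd m d (m (m a)))
  | IStore a s => Config (pc c).+1 (upd m (m a) (m s))
  | IJz a t => Config (if m a == 0 then t else (pc c).+1) m
  | IJmp t => Config t m
  | IHalt => c
  end.

Definition init_conf (w : seq nat) : config :=
  Config 0 (fun a => nth 0 (size w :: w) a).

Definition output (c : config) : seq nat :=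
  [seq mem c i | i <- iota 1 (mem c 0)].

Definition halts_in (p : program) (w : seq nat) (t : nat)
  (P : seq nat -> Prop) : Prop :=
  let c := iter t (step p) (init_conf w) in
  is_halted p c /\ P (output c).

(* Main.v *)
Require Import Defs.
From mathcomp Require Import all_boot zify.
Set Implicit Arguments.
Unset Strict Implicit.
Unset Printing Implicit Defensive.

(* Let Y(F) be the largest feasible set avoiding F; it is the least fixed point of the
   operator "y is not in F and every rule (B, y) has y in B or meets X".  Then
   tau(C) is the complement of Y(C), and (A, q) is critical iff some input rule (B, q)
   is not hit by Y = Y(B + q), A consists of the s in B all of whose rules are hit by Y,
   and every rule (B', q) not hit by Y has A included in B'.  In that case all such
   (B', q) have the same Y and yield the same A, so duplicates are avoided by letting
   only the first of them report.  For one rule, Y is computed in linear time by forward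
   chaining: every element keeps the number of its rules that are not yet hit, and joins
   Y when this number drops to 0.

   The RAM program is obtained from a small language in which every loop runs over
   0, ..., L - 1, where L is the length of the input.  Its semantics is a total function
   and its running time a function of L alone, quadratic because loops are nested at
   most twice; L is linear in the size of the rule set. *)

(** * Feasible sets and critical rules *)

(** Why every critical rule comes from an input rule: put C = A + q and Y = Y(C). That tau(C) minus
    q is not closed means that q cannot be added to Y, so some input rule (B, q) is not hit by Y.
    That tau(C) minus {q, s} is closed then forces s to be added before q and to hit every such
    rule, so A lies in B. An element of B outside A is not free: otherwise it would belong to Y,
    which B misses. Three obstacles shape the program. The ground set may be far larger than the
    input, so no loop can sweep it, and counters indexed by elements are reset only at elements that
    occur in some rule. An element that joins Y may have many occurrences; an inner loop over them
    would spoil the nesting depth, so they enter the queue one by one along a linked list. Last, the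
    input starts at cell 1, where the registers have to be, and the output must end up there too, so
    both are moved out of the way of the registers. *)

Lemma disjointsU1 (T : finType) (x : T) (A B : {set T}) :
  [disjoint x |: A & B] = (x \notin B) && [disjoint A & B].
Proof. by rewrite -!setI_eq0 setIUl setU_eq0 setI_eq0 disjoints1. Qed.

Section Feasible.
Variables (n : nat) (R : {set rule n}).
Implicit Types (F X Y Z W A B C : {set 'I_n}) (r : rule n) (q s y : 'I_n).

(** A rule whose body contains its head is accepted by every set, so it never counts as unhit. *)
Definition unhit W r := (r.2 \notin r.1) && [disjoint r.1 & W].

Definition free W y := [forall r in R, (r.2 == y) ==> ~~ unhit W r].

Definition grow F W : {set 'I_n} := [set y | (y \notin F) && free W y].

(* The largest feasible set avoiding [F]. *)
Definition maxfeas F : {set 'I_n} := fixset (grow F).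

Lemma unhitS W W' r : W \subset W' -> unhit W' r -> unhit W r.
Proof. by rewrite /unhit => sW /andP[-> d]; rewrite (disjointWr sW d). Qed.

Lemma freeP W y :
  reflect (forall r, r \in R -> r.2 = y -> ~~ unhit W r) (free W y).
Proof.
apply: (iffP forall_inP) => h r rR; first by move=> e; have := h r rR; rewrite e eqxx.
by apply/implyP => /eqP; apply: h.
Qed.

Lemma freeS W W' y : W \subset W' -> free W y -> free W' y.
Proof.
by move=> sW /freeP h; apply/freeP => r rR e; apply: contra (h r rR e); apply: unhitS.
Qed.

Lemma growS F : {homo grow F : W W' / W \subset W'}.
Proof.
move=> W W' sW; apply/subsetP => y; rewrite !inE => /andP[-> /=].
exact: freeS.
Qed.

Lemma maxfeasE F : grow F (maxfeas F) = maxfeas F.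
Proof. exact: fixsetK (@growS F). Qed.

Lemma maxfeas_notin F y : y \in maxfeas F -> y \notin F.
Proof. by rewrite -maxfeasE inE => /andP[]. Qed.

Lemma maxfeas_in F y : y \notin F -> free (maxfeas F) y -> y \in maxfeas F.
Proof. by move=> yF fy; rewrite -maxfeasE inE yF. Qed.

(** Least fixed point induction: the iterates of [grow F] from the empty set never leave [W]. *)
Lemma maxfeas_ind F W :
  (forall y, y \notin F -> free W y -> y \in W) -> maxfeas F \subset W.
Proof.
move=> h; rewrite /maxfeas /fixset; elim: #|_| => [|k IH] /=; first exact: sub0set.
apply: subset_trans (growS F IH) _; apply/subsetP => y; rewrite inE => /andP[]; exact: h.
Qed.

Lemma maxfeasS F F' : F \subset F' -> maxfeas F' \subset maxfeas F.
Proof.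
move=> sF; apply: maxfeas_ind => y yF; apply: maxfeas_in.
by apply: contra yF; apply: (subsetP sF).
Qed.

(** The elements of [maxfeas F] can be added in the same order while avoiding [F']. The induction
    bears on the intersection, because a new element is known to miss [F'] only through its
    membership in [maxfeas F]. *)
Lemma maxfeas_sub F F' : [disjoint maxfeas F & F'] -> maxfeas F \subset maxfeas F'.
Proof.
move=> d; suff: maxfeas F \subset maxfeas F :&: maxfeas F' by rewrite subsetI => /andP[].
apply: maxfeas_ind => y yF fy.
have yM : y \in maxfeas F by apply: maxfeas_in yF (freeS _ fy); apply: subsetIl.
rewrite inE yM; apply: maxfeas_in; last exact: freeS (subsetIr _ _) fy.
by rewrite (disjointFr d yM).
Qed.

(** Acceptance speaks of a set that already contains [y], freeness of the set before [y] joins. They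
    agree because a witness equal to [y] would put the head of the rule in its body. *)
Lemma accepts_free X :
  X \in Kfam R -> forall Z y, y \in X -> X :\ y \subset Z -> free Z y.
Proof.
rewrite inE => /forall_inP K Z y yX sZ; apply/freeP => r rR e; apply/negP => /andP[yr d].
have := K r rR; rewrite /accepts e yX /= => /set0Pn[z]; rewrite inE => /andP[zX zr].
have zZ : z \in Z.
  apply: (subsetP sZ); rewrite !inE zX andbT.
  by apply: contraNneq yr => zy; rewrite e -zy.
by rewrite (disjointFr d zr) in zZ.
Qed.

Lemma free_accepts X : (forall y, y \in X -> free X y) -> X \in Kfam R.
Proof.
move=> h; rewrite inE; apply/forall_inP => r rR; apply/implyP => rX.
have /freeP/(_ r rR erefl) := h _ rX.
rewrite /unhit negb_and negbK => /orP[r12|].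
  by apply/set0Pn; exists r.2; rewrite inE rX.
by rewrite disjoint_sym -setI_eq0.
Qed.

(** Along a tight path each new element is free for the set before it, so the path can be replayed
    inside [maxfeas (~: X)]. Conversely, a maximal reachable subset of [X] is stable under adding
    free elements of [X], hence is all of [X]. *)
Lemma AfamP X : reflect (X \subset maxfeas (~: X)) (X \in Afam R).
Proof.
apply: (iffP idP) => [|sX].
  rewrite inE => /andP[_ /connectP[p]].
  have: set0 \subset maxfeas (~: set0) by exact: sub0set.
  elim: p set0 => [|Z p IH] Y sY /= => [_ -> //|/andP[st pth] e].
  apply: IH pth e; case/and4P: st => _ KZ sYZ /cards1P[x dx].
  have ZE z : z \in Z -> z \notin Y -> z = x.
    by move=> zZ zY; apply/set1P; rewrite -dx inE zY.
  have xZ : x \in Z by have := set11 x; rewrite -dx => /setDP[].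
  have sM : Y \subset maxfeas (~: Z).
    by apply: subset_trans sY (maxfeasS _); rewrite setCS.
  apply/subsetP => z zZ; have [/(subsetP sM)//|zY] := boolP (z \in Y).
  apply: maxfeas_in; first by rewrite inE negbK.
  apply: (accepts_free KZ zZ); apply: subset_trans sM; apply/subsetP => w.
  rewrite !inE => /andP[wz wZ]; apply: contraNT wz => wY.
  by rewrite (ZE _ wZ wY) (ZE _ zZ zY).
pose P Z := [&& Z \subset X, Z \in Kfam R & connect (tight_step (Kfam R)) set0 Z].
have P0 : P set0.
  by rewrite /P sub0set connect0 andbT; apply: free_accepts => y; rewrite inE.
case: (@arg_maxnP _ set0 P (fun Z => #|Z|) P0) => Z /and3P[ZX KZ cZ] Zmax.
have [XZ|] := boolP (X \subset Z).
  have <- : Z = X by apply/eqP; rewrite eqEsubset ZX.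
  by rewrite inE KZ.
move=> XZ; case/negP: XZ; apply: subset_trans sX _; apply: maxfeas_ind => y.
rewrite inE negbK => yX fy; apply: contraT => yZ.
have KyZ : y |: Z \in Kfam R.
  apply: free_accepts => z; rewrite !inE => /orP[/eqP->|zZ].
    exact: freeS (subsetUr _ _) fy.
  apply: (accepts_free KZ zZ); apply: subset_trans (subsetUr _ _); exact: subD1set.
have: P (y |: Z).
  rewrite /P subUset sub1set yX ZX KyZ /=; apply: connect_trans cZ (connect1 _).
  rewrite /tight_step KZ KyZ subsetUr /= setDUl setDv setU0.
  have -> : [set y] :\: Z = [set y]; last by rewrite cards1.
  by apply/setDidPl; rewrite disjoints1.
by move/Zmax; rewrite /geq /= cardsU1 yZ add1n ltnn.
Qed.

Lemma maxfeas_Afam F : maxfeas F \in Afam R.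
Proof. by apply/AfamP/maxfeas_sub; rewrite -subsets_disjoint. Qed.

Lemma Afam_maxfeas F X : X \in Afam R -> [disjoint X & F] -> X \subset maxfeas F.
Proof.
move/AfamP => sX d; apply: subset_trans sX (maxfeasS _).
by rewrite subsetC -disjoints_subset.
Qed.

Lemma dualE (G : {set {set 'I_n}}) X : (X \in dualfam G) = (~: X \in G).
Proof.
apply/imsetP/idP => [[Y YG ->]|XG]; first by rewrite setCK.
by exists (~: X); rewrite ?setCK.
Qed.

Lemma tauE C : tau (Afam R) C = ~: maxfeas C.
Proof.
apply/eqP; rewrite eqEsubset; apply/andP; split.
  apply: bigcap_inf; rewrite dualE setCK maxfeas_Afam /=.
  apply/subsetP => y yC; rewrite inE; apply: contraL yC; exact: maxfeas_notin.
apply/bigcapsP => Y; rewrite dualE => /andP[YA CY]; rewrite -setCS setCK.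
apply: Afam_maxfeas YA _; rewrite disjoint_sym disjoints_subset setCK //.
Qed.

(** If [q] is not free, the fixed point restricted to [q |: maxfeas C] stalls at [maxfeas C] and
    never reaches [q]. *)
Lemma AfamU1 C q : q \in C ->
  (q |: maxfeas C \in Afam R) = free (maxfeas C) q.
Proof.
move=> qC; set Y := maxfeas C; have qY : q \notin Y by apply: contraL qC => /maxfeas_notin.
have sY X : Y \subset X -> Y \subset maxfeas (~: X).
  by move=> YX; apply: maxfeas_sub; rewrite -subsets_disjoint.
apply/AfamP/idP => [s|fq]; last first.
  rewrite subUset sub1set sY ?subsetUr // andbT; apply: maxfeas_in.
    by rewrite !inE eqxx.
  by apply: freeS fq; apply: sY; apply: subsetUr.
apply: contraT => nf; case/negP: qY; apply: (subsetP _ q (setU11 q Y)).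
apply: subset_trans s (maxfeas_ind _) => y; rewrite !inE negbK => /orP[/eqP->|//] fy.
by rewrite fy in nf.
Qed.

(** As [q] is not free, [s] has to join first and must then free [q]; otherwise the fixed point
    stalls at [maxfeas C] or at [s |: maxfeas C]. *)
Lemma AfamU2 C q s : q \in C -> s \in C -> s != q -> ~~ free (maxfeas C) q ->
  (s |: (q |: maxfeas C) \in Afam R) = free (maxfeas C) s && free (s |: maxfeas C) q.
Proof.
move=> qC sC sq nfq; set Y := maxfeas C.
have inC y : y \in C -> y \notin Y by move=> yC; apply: contraL yC => /maxfeas_notin.
have qY := inC q qC; have sY := inC s sC.
apply/AfamP/andP => [sX|[fs fq]].
  set X := _ |: _ in sX; have qX : q \in X by rewrite !inE eqxx orbT.
  split; apply: contraT => nf.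
    case/negP: qY; apply: (subsetP _ q qX); apply: subset_trans sX (maxfeas_ind _) => y.
    rewrite !inE negbK => /or3P[/eqP->|/eqP->|//] fy; by [rewrite fy in nf | rewrite fy in nfq].
  suff: q \in s |: Y by rewrite !inE (negPf qY) eq_sym (negPf sq).
  apply: (subsetP _ q qX); apply: subset_trans sX (maxfeas_ind _) => y.
  rewrite !inE negbK => /or3P[->//|/eqP->|->]; last by rewrite orbT.
  by move=> fy; rewrite fy in nf.
have Ym : Y \subset maxfeas (~: (s |: (q |: Y))).
  by apply: maxfeas_sub; rewrite -subsets_disjoint setUA subsetUr.
have sm : s \in maxfeas (~: (s |: (q |: Y))).
  by apply: maxfeas_in; [rewrite !inE eqxx | apply: freeS fs].
rewrite !subUset !sub1set sm Ym andbT /=; apply: maxfeas_in.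
  by rewrite !inE eqxx orbT.
by apply: freeS fq; rewrite subUset sub1set sm.
Qed.

Lemma criticalE A q : critical (Afam R) (A, q) =
  [&& q \notin A, ~~ free (maxfeas (q |: A)) q
    & [forall s in A, free (maxfeas (q |: A)) s && free (s |: maxfeas (q |: A)) q]].
Proof.
rewrite /critical /= tauE !dualE; case: (boolP (q \notin A)) => //= qA.
have qC : q \in q |: A by rewrite setU11.
rewrite setCD setCK [maxfeas _ :|: _]setUC AfamU1 //.
case: (boolP (free _ q)) => //= nf; apply: eq_forallb => s; case: (boolP (s \in A)) => //= sA.
rewrite dualE !setCD setCK -!(setUC [set _]) AfamU2 //.
- by rewrite setU1r.
- by apply: contraNneq qA => <-.
Qed.

Definition tails W B := [set s in B | free W s].

(* [r = (B, q)] yields the critical rule [(tails (maxfeas (q |: B)) B, q)]. *)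
Definition yields r :=
  let W := maxfeas (r.2 |: r.1) in
  [&& r \in R, unhit W r & [forall r' in R, (r'.2 == r.2) && unhit W r' ==>
     (tails W r.1 \subset r'.1)]].

Lemma yields_unhit r r' : let W := maxfeas (r.2 |: r.1) in
  yields r -> r' \in R -> r'.2 = r.2 -> unhit W r' -> tails W r.1 \subset r'.1.
Proof.
by move=> W /and3P[_ _ /forall_inP h] rR e u; apply: (implyP (h r' rR)); rewrite e eqxx.
Qed.

(** An element of [r.1] outside the tails is not free for [W], so lifting the ban on it adds
    nothing. *)
Lemma maxfeas_tails r : let W := maxfeas (r.2 |: r.1) in
  maxfeas (r.2 |: tails W r.1) = W.
Proof.
move=> W; apply/eqP; rewrite eqEsubset; apply/andP; split; last first.
  by apply: maxfeasS; apply: setUS; apply/subsetP => s; rewrite inE => /andP[].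
apply: maxfeas_ind => y; rewrite !inE negb_or negb_and => /andP[yr h fy].
move: h; rewrite fy orbF => yB.
by apply: maxfeas_in => //; rewrite !inE negb_or yr.
Qed.

(** One inclusion holds because [r'.1] contains the tails, which already determine [W]; the other
    because [W] misses both [r'.1] and the head. *)
Lemma maxfeas_unhit r r' : let W := maxfeas (r.2 |: r.1) in
  yields r -> r' \in R -> r'.2 = r.2 -> unhit W r' -> maxfeas (r'.2 |: r'.1) = W.
Proof.
move=> W yr rR e u; have s := yields_unhit yr rR e u.
apply/eqP; rewrite eqEsubset; apply/andP; split.
  by rewrite -{2}/W -[W]maxfeas_tails e; apply: maxfeasS; apply: setUS.
apply: maxfeas_sub; rewrite disjoint_sym disjointsU1 e.
case/andP: u => _ ->; rewrite andbT; apply/negP => /maxfeas_notin.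
by rewrite setU11.
Qed.

(** A free element of [r'.1] outside [r.1] would join [W], which [r'.1] misses. This allows one rule
    to report for all of them. *)
Lemma tails_unhit r r' : let W := maxfeas (r.2 |: r.1) in
  yields r -> r' \in R -> r'.2 = r.2 -> unhit W r' ->
  yields r' /\ tails W r'.1 = tails W r.1.
Proof.
move=> W yr rR e u; have s := yields_unhit yr rR e u.
have eW := maxfeas_unhit yr rR e u; rewrite -/W in eW s.
have et : tails W r'.1 = tails W r.1.
  apply/eqP; rewrite eqEsubset; apply/andP; split; apply/subsetP => z; last first.
    by move=> zt; rewrite inE (subsetP s z zt); move: zt; rewrite inE => /andP[].
  rewrite !inE => /andP[zr fz]; rewrite fz andbT; apply: contraT => zB.
  suff: z \in W.
    by move/(disjointFl (proj2 (andP u))); rewrite zr.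
  apply: maxfeas_in fz; rewrite !inE negb_or zB andbT -e.
  by case/andP: u => + _; apply: contraNneq => <-.
split=> //; rewrite /yields eW rR u et /= e; by case/and3P: yr.
Qed.

Lemma criticalP A q : reflect
  (exists r, [/\ yields r, r.2 = q & A = tails (maxfeas (r.2 |: r.1)) r.1])
  (critical (Afam R) (A, q)).
Proof.
rewrite criticalE; apply: (iffP and3P) => [[qA nf /forall_inP h]|]; last first.
  case=> r [yr <- ->]; have := maxfeas_tails r; set W := maxfeas (_ |: r.1) => /= eW.
  rewrite eW; split.
  - by case/and3P: yr => _ /andP[rr _] _; rewrite inE negb_and rr.
  - case/and3P: yr => rR u _; apply/negP => /freeP/(_ r rR erefl).
    by rewrite u.
  - apply/forall_inP => s st; have -> /= : free W s by move: st; rewrite inE => /andP[].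
    apply/freeP => r' rR' e; apply/negP => u'.
    have u : unhit W r' by apply: unhitS u'; apply: subsetUr.
    have sr' := subsetP (yields_unhit yr rR' e u) s st.
    by case/andP: u' => _ d; move: (disjointFr d sr'); rewrite setU11.
set W := maxfeas _ in nf h *.
(* Since [q] is not free, some input rule with head [q] is unhit; it will yield [(A, q)]. *)
have [r /and3P[rR /eqP rq u]] : exists r, [&& r \in R, r.2 == q & unhit W r].
  move: nf; rewrite negb_forall => /existsP[r] hr; exists r; move: hr.
  by case: (r \in R) => //=; case: (r.2 == q) => //=; rewrite negbK.
(* Adding [s] to [W] makes [q] free, so it hits [r'], which [W] alone does not: [s] lies in
   [r'.1]. *)
have AB r' : r' \in R -> r'.2 = q -> unhit W r' -> A \subset r'.1.
  move=> rR' e u'; apply/subsetP => s sA; have /andP[_ /freeP/(_ r' rR' e)] := h s sA.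
  apply: contraR => sr'; rewrite /unhit (proj1 (andP u')) disjoint_sym disjointsU1 sr'.
  by rewrite disjoint_sym; case/andP: u'.
have eW : maxfeas (r.2 |: r.1) = W.
  apply/eqP; rewrite eqEsubset; apply/andP; split.
    by apply: maxfeasS; rewrite rq setUS ?AB.
  apply: maxfeas_sub; rewrite disjoint_sym disjointsU1.
  case/andP: u => _ ->; rewrite andbT; apply/negP => /maxfeas_notin.
  by rewrite rq setU11.
have eA : A = tails W r.1.
  apply/setP => s; rewrite inE; apply/idP/andP => [sA|[sr fs]].
    by rewrite (subsetP (AB r rR rq u)) //; have /andP[] := h s sA.
  apply: contraT => sA; suff: s \in W.
    by move/(disjointFl (proj2 (andP u))); rewrite sr.
  apply: maxfeas_in fs; rewrite !inE negb_or sA andbT -rq.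
  by case/andP: u => + _; apply: contraNneq => <-.
exists r; rewrite /yields eW rR u -eA; split=> //=; apply/forall_inP => r' rR'.
by apply/implyP => /andP[/eqP e u']; rewrite AB // e.
Qed.

End Feasible.

Lemma split_first (T : Type) (a : pred T) (s : seq T) : has a s ->
  exists l1 x l2, [/\ s = l1 ++ x :: l2, a x & ~~ has a l1].
Proof.
elim: s => //= y s IH; case: (boolP (a y)) => [ay _|ay /= /IH[l1 [x [l2 [-> ax nl]]]]].
  by exists [::], y, s.
by exists (y :: l1), x, l2; rewrite /= negb_or ay.
Qed.

(** * Listing the critical rules without repetition *)

Section Listing.
Variables (n : nat) (R : {set rule n}).
Implicit Types (x r : seq 'I_n * 'I_n) (P l : seq (seq 'I_n * 'I_n)).

(** By [tauE] this is the complement of the [tau]-closure of the body and head of [x]; it is closed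
    in the sense of forward chaining. *)
Definition closure_of x := maxfeas R (x.2 |: [set a in x.1]).

Definition same_unhit x y := (y.2 == x.2) && unhit (closure_of x) (rule_of y).

(* Rules heading [x.2] that are not hit by the same closure yield the same critical
   rule; only the first of them emits it. *)
Definition emits P x := yields R (rule_of x) && ~~ has (same_unhit x) P.

Definition emitted x := ([seq s <- x.1 | free R (closure_of x) s], x.2).

Fixpoint listing P l :=
  if l is x :: l' then
    (if emits P x then [:: emitted x] else [::]) ++ listing (rcons P x) l'
  else [::].

Lemma listing_rcons P l x : listing P (rcons l x) =
  listing P l ++ (if emits (P ++ l) x then [:: emitted x] else [::]).
Proof.
elim: l P => [|y l IH] P /=; first by rewrite !cats0.
by rewrite IH catA cat_rcons.
Qed.

Lemma rule_of_emitted x :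
  rule_of (emitted x) = (tails R (closure_of x) [set a in x.1], x.2).
Proof. by congr (_, _); apply/setP => s; rewrite !inE mem_filter andbC. Qed.

Lemma listingP P l y : reflect
  (exists l1 x l2, [/\ l = l1 ++ x :: l2, emits (P ++ l1) x & y = emitted x])
  (y \in listing P l).
Proof.
apply: (iffP idP) => [|[l1 [x [l2 [-> ex ->]]]]].
  elim: l P => //= x l IH P; rewrite mem_cat => /orP[|/IH[l1 [z [l2 [-> ez ->]]]]].
    case: ifP => //= ex; rewrite inE => /eqP ->.
    by exists [::], x, l; split=> //; rewrite cats0.
  by exists (x :: l1), z, l2; split=> //; rewrite -cat_rcons.
elim: l1 P ex => [|z l1 IH] P /= ex; rewrite mem_cat.
  by rewrite cats0 in ex; rewrite ex inE eqxx.
by rewrite IH ?orbT // cat_rcons.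
Qed.

(** By [maxfeas_tails] an emitted rule determines the closure it came from, so the earlier of two
    rules with equal reports silences the later one. *)
Lemma uniq_listing P l : uniq (map (@rule_of n) (listing P l)).
Proof.
elim: l P => //= x l IH P; case: ifP => //= ex; rewrite IH andbT.
apply/mapP => -[y /listingP[l1 [z [l2 [_ ez ->]]]]]; rewrite !rule_of_emitted => -[et e2].
case/andP: ez => _ /hasPn/(_ x); rewrite mem_cat mem_rcons inE eqxx => /(_ isT).
rewrite /same_unhit e2 eqxx /=; case/andP: ex => yx _.
have -> : closure_of z = closure_of x.
  by rewrite /closure_of -[LHS](maxfeas_tails R (rule_of z)) -[RHS](maxfeas_tails R (rule_of x)) /= et e2.
by case/and3P: yx => _ -> _.
Qed.

End Listing.

Lemma listing_critical n (rs : seq (seq 'I_n * 'I_n)) (R := set_of_rules rs) :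
  set_of_rules (listing R [::] rs) = critical_rules (Afam R).
Proof.
apply/setP => -[A q]; rewrite !inE; apply/mapP/criticalP => [[y]|[r [yr rq AE]]].
  case/listingP=> l1 [x [l2 [_ /andP[yx _] ->]]]; rewrite rule_of_emitted => -[-> ->].
  by exists (rule_of x).
have [rR ur _] := and3P yr; have [x0 x0rs r0] : exists2 x, x \in rs & r = rule_of x.
  by move: rR; rewrite inE => /mapP.
have hs : has (same_unhit R x0) rs.
  by apply/hasP; exists x0; rewrite // /same_unhit eqxx /= /closure_of -r0; move: ur; rewrite r0.
(* The first rule with the same head that this closure leaves unhit reports in place of [x0]. *)
have [l1 [x [l2 [rsE /andP[/eqP x2 ux] nl1]]]] := split_first hs.
have xR : rule_of x \in R by rewrite inE map_f // rsE mem_cat inE eqxx orbT.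
have ux' : unhit (maxfeas R (r.2 |: r.1)) (rule_of x) by rewrite r0.
have x2' : (rule_of x).2 = r.2 by rewrite r0.
have [yx tx] := tails_unhit yr xR x2' ux'.
have mx := maxfeas_unhit yr xR x2' ux'.
exists (emitted R x).
  apply/listingP; exists l1, x, l2; split=> //; rewrite /emits yx /=.
  by apply: contra nl1; apply: sub_has => z; rewrite /same_unhit /closure_of mx x2 r0.
by rewrite rule_of_emitted /closure_of mx tx -AE -rq r0 x2.
Qed.

Lemma listing_wf n (R : {set rule n}) (rs : seq (seq 'I_n * 'I_n)) :
  wf_rules rs -> wf_rules (listing R [::] rs).
Proof.
case/andP=> /allP us _; rewrite /wf_rules uniq_listing andbT; apply/allP => y.
case/listingP=> l1 [x [l2 [rsE _ ->]]]; apply: filter_uniq; apply: us.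
by rewrite rsE mem_cat inE eqxx orbT.
Qed.

(** Hence the output fits into the cells of the input, and array 16 can receive what lies beyond the
    registers. *)
Lemma size_enc_listing n (R : {set rule n}) P (rs : seq (seq 'I_n * 'I_n)) :
  size (flatten (map (@enc_rule n) (listing R P rs))) <= size (flatten (map (@enc_rule n) rs)).
Proof.
elim: rs P => // x rs IH P; rewrite [listing _ _ _]/= -[x :: rs]cat1s.
rewrite !map_cat !flatten_cat !size_cat leq_add //.
by case: ifP => //= _; rewrite !cats0 /= !size_map size_filter addn0 !ltnS count_size.
Qed.

(** * A loop language compiled to the RAM *)

Inductive expr :=
  V of nat | N of nat | Plus of expr & expr | Minus of expr & expr | Get of nat & expr.

Inductive cmd :=
| Skip
| Assign of nat & expr
| Put of nat & expr & expr
| Seq of cmd & cmd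
| If of expr & cmd & cmd
| Loop of nat & cmd.

Record store := Store { va : nat -> nat; ar : nat -> nat -> nat }.

Definition setv s x w := Store (fun y => if y == x then w else va s y) (ar s).
Definition seta s j i w :=
  Store (va s) (fun j' i' => if (j' == j) && (i' == i) then w else ar s j' i').

(* Cells below [rawb] are registers: 0 holds the base address of the arrays,
   1 the input length, 2..23 the variables, 24..47 temporaries. *)
Definition rawb := 48.

Section Semantics.
Variable L : nat.

(* Arrays 0..15 are infinite and interleaved above the input; array 16 is the part of
   the input region lying above the registers, with indices clamped to its size. *)
Definition idx j i := if j == 16 then minn i (L - rawb) else i.

Definition loc j i :=
  if j == 16 then rawb + minn i (L - rawb) else L + rawb.+1 + 16 * i + j.

Fixpoint eval s e :=
  match e with
  | V x => va s x
  | N k => k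
  | Plus a b => eval s a + eval s b
  | Minus a b => eval s a - eval s b
  | Get j e => ar s j (idx j (eval s e))
  end.

(* The bound of a loop is always the input length, so that running times
   do not depend on the store. *)
Fixpoint run c s :=
  match c with
  | Skip => s
  | Assign x e => setv s x (eval s e)
  | Put j e1 e2 => seta s j (idx j (eval s e1)) (eval s e2)
  | Seq c1 c2 => run c2 (run c1 s)
  | If e c1 c2 => if eval s e == 0 then run c2 s else run c1 s
  | Loop x c => foldl (fun s i => run c (setv s x i)) s (iota 0 L)
  end.

Fixpoint ecost e :=
  match e with
  | V _ => 2
  | N _ => 1
  | Plus a b | Minus a b => ecost a + ecost b + 1
  | Get _ e => ecost e + 8
  end.

(** An upper bound that charges both branches of a conditional. For a loop, 7 counts the test, the
    copy of the counter and the increment with its jump; 3 counts the initialisation and the last,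
    failing test. *)
Fixpoint cost c :=
  match c with
  | Skip => 0
  | Assign _ e => ecost e + 2
  | Put _ e1 e2 => ecost e1 + ecost e2 + 8
  | Seq c1 c2 => cost c1 + cost c2
  | If e c1 c2 => ecost e + cost c1 + cost c2 + 2
  | Loop _ c => L * (cost c + 7) + 3
  end.

End Semantics.

Fixpoint depth c :=
  match c with
  | Seq c1 c2 | If _ c1 c2 => maxn (depth c1) (depth c2)
  | Loop _ c => (depth c).+1
  | _ => 0
  end.

Lemma cost_poly c : exists k, forall L, cost L c <= k * L.+1 ^ depth c.
Proof.
elim: c => [|x e|j e1 e2|c1 [k1 h1] c2 [k2 h2]|e c1 [k1 h1] c2 [k2 h2]|x c [k h]] /=.
- by exists 0.
- by exists (ecost e + 2) => L; rewrite muln1.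
- by exists (ecost e1 + ecost e2 + 8) => L; rewrite muln1.
- exists (k1 + k2) => L; rewrite mulnDl; apply: leq_add.
    by apply: leq_trans (h1 L) _; rewrite leq_mul2l leq_pexp2l ?leq_maxl ?orbT.
  by apply: leq_trans (h2 L) _; rewrite leq_mul2l leq_pexp2l ?leq_maxr ?orbT.
- exists (ecost e + 2 + k1 + k2) => L.
  have -> : ecost e + cost L c1 + cost L c2 + 2 = ecost e + 2 + cost L c1 + cost L c2 by lia.
  rewrite !mulnDl; apply: leq_add; first apply: leq_add.
  + by rewrite -mulnDl leq_pmulr // expn_gt0.
  + by apply: leq_trans (h1 L) _; rewrite leq_mul2l leq_pexp2l ?leq_maxl ?orbT.
  + by apply: leq_trans (h2 L) _; rewrite leq_mul2l leq_pexp2l ?leq_maxr ?orbT.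
(* The power is at least 1, so the additional 10 absorbs the 7 per round and the final 3. *)
- exists (k + 10) => L; have := h L; have := expn_gt0 L.+1 (depth c); rewrite expnS /=.
  by set y := _ ^ _; nia.
Qed.

(** [t] is the first free temporary. The value of an expression ends up in register [t]; evaluation
    may overwrite later temporaries but must stay below [rawb]. *)
Fixpoint wf_expr t e :=
  match e with
  | V x => (x < 22) && (t < rawb)
  | N _ => t < rawb
  | Plus a b | Minus a b => wf_expr t a && wf_expr t.+1 b
  | Get j e => [&& j <= 16, wf_expr t e & t.+2 < rawb]
  end.

Fixpoint wf_cmd t c :=
  match c with
  | Skip => true
  | Assign x e => [&& x < 22, wf_expr t e & t.+1 < rawb]
  | Put j e1 e2 => [&& j <= 16, wf_expr t e1, t.+2 < rawb & wf_expr t.+1 e2]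
  | Seq c1 c2 => wf_cmd t c1 && wf_cmd t c2
  | If e c1 c2 => [&& wf_expr t e, wf_cmd t c1 & wf_cmd t c2]
  | Loop x c => [&& x < 22, t.+1 < rawb & wf_cmd t.+1 c]
  end.

(** The machine cannot multiply: the factor 16 is four doublings. For array 16 the minimum of [i]
    and [d] is computed as [d - (d - i)] with truncated subtraction. *)
Definition addr_code t j :=
  if j == 16 then
    [:: IConst t.+1 rawb; ISub t.+2 1 t.+1; ISub t t.+2 t; ISub t t.+2 t; IAdd t t t.+1]
  else
    [:: IAdd t t t; IAdd t t t; IAdd t t t; IAdd t t t; IAdd t t 0; IConst t.+1 j;
        IAdd t t t.+1].

(** There is no move instruction; a register is copied by adding it to 0. *)
Fixpoint expr_code t e :=
  match e with
  | V x => [:: IConst t 0; IAdd t t x.+2]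
  | N k => [:: IConst t k]
  | Plus a b => expr_code t a ++ expr_code t.+1 b ++ [:: IAdd t t t.+1]
  | Minus a b => expr_code t a ++ expr_code t.+1 b ++ [:: ISub t t t.+1]
  | Get j e => expr_code t e ++ addr_code t j ++ [:: ILoad t t]
  end.

(** [o] is the address of the first instruction, needed because jumps are absolute. A loop counts in
    its own temporary [t] and copies the counter to [x], so that, as in [run], the body may change
    [x] without affecting the rounds. *)
Fixpoint cmd_code o t c :=
  match c with
  | Skip => [::]
  | Assign x e => expr_code t e ++ [:: IConst t.+1 0; IAdd x.+2 t t.+1]
  | Put j e1 e2 =>
      expr_code t e1 ++ addr_code t j ++ expr_code t.+1 e2 ++ [:: IStore t t.+1]
  | Seq c1 c2 =>
      let l1 := cmd_code o t c1 in l1 ++ cmd_code (o + size l1) t c2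
  | If e c1 c2 =>
      let le := expr_code t e in
      let l1 := cmd_code (o + size le).+1 t c1 in
      let o2 := (o + size le + size l1).+2 in
      let l2 := cmd_code o2 t c2 in
      le ++ IJz t o2 :: l1 ++ IJmp (o2 + size l2) :: l2
  | Loop x c =>
      let l := cmd_code (o + 5) t.+1 c in
      [:: IConst t 0; ISub t.+1 1 t; IJz t.+1 (o + size l + 8); IConst t.+1 0; IAdd x.+2 t t.+1]
      ++ l ++ [:: IConst t.+1 1; IAdd t t t.+1; IJmp o.+1]
  end.

(** * Correctness of the compiler *)

Definition straight i :=
  match i with IJz _ _ | IJmp _ | IHalt => false | _ => true end.

Definition ex1 m i := Defs.mem (step [:: i] (Config 0 m)).
Definition exs m l := foldl ex1 m l.

Definition code_at p o l := forall i, i < size l -> fetch p (o + i) = nth IHalt l i.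

Lemma code_at_cat p o l1 l2 :
  code_at p o (l1 ++ l2) -> code_at p o l1 /\ code_at p (o + size l1) l2.
Proof.
move=> h; split=> i il.
  by rewrite h ?nth_cat ?il // size_cat; lia.
by rewrite -addnA h ?nth_cat ?size_cat; [case: ltnP => ?; [lia | congr nth; lia] | lia].
Qed.

Lemma code_at_cons p o i l :
  code_at p o (i :: l) -> fetch p o = i /\ code_at p o.+1 l.
Proof.
move=> h; split; first by have := h 0 isT; rewrite addn0.
by move=> j jl; have := h j.+1 jl; rewrite addnS.
Qed.

Lemma step_straight p o m i :
  fetch p o = i -> straight i -> step p (Config o m) = Config o.+1 (ex1 m i).
Proof. by rewrite /step /ex1 /= => ->; case: i. Qed.

Lemma iter_straight p o l m : all straight l -> code_at p o l ->
  iter (size l) (step p) (Config o m) = Config (o + size l) (exs m l).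
Proof.
elim: l o m => [|i l IH] o m /=; first by rewrite addn0.
move=> /andP[si sl] /code_at_cons[fi cl]; rewrite -iterS iterSr.
by rewrite (step_straight _ fi si) IH // addSnnS.
Qed.

Lemma exs_cat m l1 l2 : exs m (l1 ++ l2) = exs (exs m l1) l2.
Proof. exact: foldl_cat. Qed.

Lemma straight_addr t j : all straight (addr_code t j).
Proof. by rewrite /addr_code; case: ifP. Qed.

Lemma straight_expr t e : all straight (expr_code t e).
Proof.
by elim: e t => //= [a IHa b IHb|a IHa b IHb|j e IH] t; rewrite !all_cat ?IHa ?IHb ?IH ?straight_addr.
Qed.

Lemma size_expr_code t e : size (expr_code t e) <= ecost e.
Proof.
elim: e t => //= [a IHa b IHb|a IHa b IHb|j e IH] t; rewrite !size_cat /=.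
- by have := IHa t; have := IHb t.+1; lia.
- by have := IHa t; have := IHb t.+1; lia.
- by have := IH t; rewrite /addr_code; case: ifP => /= _; lia.
Qed.

Lemma loc_ge L j i : rawb <= loc L j i.
Proof. rewrite /loc; case: ifP => _; lia. Qed.

Lemma loc_eq L j i j' i' : j <= 16 -> j' <= 16 ->
  (loc L j' i' == loc L j i) = (j' == j) && (idx L j' i' == idx L j i).
Proof.
rewrite /loc /idx /rawb => hj hj'.
by case: (j =P 16) => ej; case: (j' =P 16) => ej';
  apply/eqP/andP => [h|[/eqP h1 /eqP h2]]; (try split; try apply/eqP); lia.
Qed.

(** Simulation relation between stores and memories; the temporaries are left unconstrained. *)
Definition related L s (m : nat -> nat) :=
  [/\ m 0 = L + rawb.+1, m 1 = L, forall x, x < 22 -> m x.+2 = va s x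
    & forall j i, j <= 16 -> m (loc L j i) = ar s j (idx L j i)].

Lemma related_frame L s m m' : related L s m ->
  (forall x, x < 24 \/ rawb <= x -> m' x = m x) -> related L s m'.
Proof.
case=> h0 h1 hv ha e; split=> [||x xv|j i ji].
- by rewrite e //; left.
- by rewrite e //; left.
- by rewrite e ?hv //; left; lia.
- by rewrite e ?ha //; right; apply: loc_ge.
Qed.

Lemma ex_addr L m t j : 1 < t -> t.+2 < rawb -> m 0 = L + rawb.+1 -> m 1 = L ->
  exs m (addr_code t j) t = loc L j (m t) /\
  forall x, x < t \/ rawb <= x -> exs m (addr_code t j) x = m x.
Proof.
rewrite /addr_code /loc /rawb => t1 t2 m0 m1; case: ifP => _.
all: rewrite /exs /= /ex1 /= /upd.
all: have [n0 [n1 [n2 n3]]] : t != 0 /\ t != 1 /\ t != t.+1 /\ t != t.+2 by lia.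
all: split=> [|x hx]; last by repeat (case: eqP => ? /=); lia.
- by rewrite !eqxx; repeat (case: eqP => ? /=); lia.
- by rewrite !eqxx; repeat (case: eqP => ? /=); lia.
Qed.

Lemma wf_expr_lt t e : wf_expr t e -> t < rawb.
Proof. by elim: e => //= [x /andP[]|a IHa b _ /andP[/IHa]|a IHa b _ /andP[/IHa]|j e _ /and3P[_ _]] //; lia. Qed.

Lemma ex_expr L s e t m : 23 < t -> wf_expr t e -> related L s m ->
  exs m (expr_code t e) t = eval L s e /\
  forall x, x < t \/ rawb <= x -> exs m (expr_code t e) x = m x.
Proof.
elim: e t m => [x|k|a IHa b IHb|a IHa b IHb|j e IH] t m t24 /=.
- case/andP=> x22 tb [_ _ hv _]; rewrite /exs /= /ex1 /= /upd; split=> [|y hy].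
    by rewrite !eqxx; case: eqP => [|_]; [lia | rewrite hv].
  by case: eqP => //; lia.
- by move=> tb _; rewrite /exs /= /ex1 /= /upd eqxx; split=> // y hy; case: eqP => //; lia.
- case/andP=> wa wb r; have tb := wf_expr_lt wa; rewrite !exs_cat /= /ex1 /= /upd eqxx.
  have [ea fa] := IHa t m t24 wa r; have r1 : related L s (exs m (expr_code t a)).
    by apply: related_frame r _ => y hy; apply: fa; lia.
  have [eb fb] := IHb t.+1 _ (leqW t24) wb r1; rewrite eb fb ?ea; last by left.
  by split=> // y hy; case: eqP => [|_]; [lia|rewrite fb ?fa //; lia].
- case/andP=> wa wb r; have tb := wf_expr_lt wa; rewrite !exs_cat /= /ex1 /= /upd eqxx.
  have [ea fa] := IHa t m t24 wa r; have r1 : related L s (exs m (expr_code t a)).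
    by apply: related_frame r _ => y hy; apply: fa; lia.
  have [eb fb] := IHb t.+1 _ (leqW t24) wb r1; rewrite eb fb ?ea; last by left.
  by split=> // y hy; case: eqP => [|_]; [lia|rewrite fb ?fa //; lia].
- case/and3P=> j16 we tb r; rewrite !exs_cat /= /ex1 /= /upd eqxx.
  have [ee fe] := IH t m t24 we r; have r1 : related L s (exs m (expr_code t e)).
    by apply: related_frame r _ => y hy; apply: fe; lia.
  have [m0 m1 _ ha] := r1; have [ei fi] := ex_addr j (ltn_trans (isT : 1 < 23) t24) tb m0 m1.
  rewrite ei ee fi ?ha //; last by right; apply: loc_ge.
  by split=> // y hy; case: eqP => [|_]; [lia|rewrite fi ?fe //; lia].
Qed.

Lemma iter_addE p a b x : iter (a + b) (step p) x = iter b (step p) (iter a (step p) x).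
Proof. by rewrite addnC iterD. Qed.

Definition reach p o m o' m' c :=
  exists2 k, k <= c & iter k (step p) (Config o m) = Config o' m'.

Lemma reach_refl p o m c : reach p o m o m c.
Proof. by exists 0. Qed.

Lemma reach_trans p o1 m1 o2 m2 o3 m3 c1 c2 c :
  c1 + c2 <= c ->
  reach p o1 m1 o2 m2 c1 -> reach p o2 m2 o3 m3 c2 -> reach p o1 m1 o3 m3 c.
Proof.
move=> hc [k1 h1 e1] [k2 h2 e2]; exists (k1 + k2); first by lia.
by rewrite iter_addE e1.
Qed.

Lemma reach_straight p o l m : all straight l -> code_at p o l ->
  reach p o m (o + size l) (exs m l) (size l).
Proof. by move=> sl cl; exists (size l); rewrite ?iter_straight. Qed.

Lemma reach_jmp p o o' m : fetch p o = IJmp o' -> reach p o m o' m 1.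
Proof. by move=> f; exists 1; rewrite //= /step /= f. Qed.

Lemma reach_jz p o a o' m : fetch p o = IJz a o' ->
  reach p o m (if m a == 0 then o' else o.+1) m 1.
Proof. by move=> f; exists 1; rewrite //= /step /= f. Qed.

Lemma related_setv L s m x w : x < 22 -> related L s m -> related L (setv s x w) (upd m x.+2 w).
Proof.
move=> x22 [m0 m1 hv ha]; rewrite /upd; split=> [//|//|y y22|j i j16] /=.
  by rewrite !eqSS; case: eqP => // _; apply: hv.
by rewrite -ha //; case: eqP => // e; have := loc_ge L j i; rewrite /rawb; lia.
Qed.

Lemma related_seta L s m j i w : j <= 16 -> related L s m ->
  related L (seta s j (idx L j i) w) (upd m (loc L j i) w).
Proof.
move=> j16 [m0 m1 hv ha]; have g := loc_ge L j i; rewrite /rawb in g.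
rewrite /upd; split=> [||y y22|j' i' j16'] /=.
- by case: eqP => //; lia.
- by case: eqP => //; lia.
- by case: eqP => [|_]; [lia | apply: hv].
- by rewrite loc_eq // ha.
Qed.

Lemma ex_addr24 L s m t j : 23 < t -> t.+2 < rawb -> related L s m ->
  exs m (addr_code t j) t = loc L j (m t) /\
  forall x, x < t \/ rawb <= x -> exs m (addr_code t j) x = m x.
Proof. by move=> t24 tb [m0 m1 _ _]; apply: ex_addr => //; lia. Qed.

Lemma cmd_correct L p c o t s m :
  23 < t -> wf_cmd t c -> code_at p o (cmd_code o t c) -> related L s m ->
  exists m', [/\ reach p o m (o + size (cmd_code o t c)) m' (cost L c),
    related L (run L c s) m' & forall x, 23 < x < t -> m' x = m x].
Proof.
elim: c o t s m => [|x e|j e1 e2|c1 IH1 c2 IH2|e c1 IH1 c2 IH2|x c IH] o t s m t24 /=.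
- by move=> _ _ r; exists m; rewrite addn0; split=> //; apply: reach_refl.
- case/and3P=> x22 we tb co r.
  have [ee fe] := ex_expr t24 we r; set l := (X in code_at _ _ X) in co *.
  have sl : all straight l by rewrite all_cat straight_expr.
  have em y : y <= 23 \/ y < t \/ rawb <= y -> exs m l y = upd m x.+2 (eval L s e) y.
    move=> hy; rewrite exs_cat /= /ex1 /= /upd.
    case: (y =P x.+2) => [yx|yx].
      rewrite !eqxx; have -> : (t == t.+1) = false by lia.
      by rewrite ee addn0.
    by case: eqP => [|_]; [lia | apply: fe; lia].
  exists (exs m l); split.
  + have [k hk ek] := reach_straight m sl co; exists k => //; apply: leq_trans hk _.
    by rewrite size_cat /=; have := size_expr_code t e; lia.
  + by apply: related_frame (related_setv _ x22 r) _ => y hy; apply: em; lia.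
  + move=> y /andP[y1 y2]; rewrite em; last by lia.
    by rewrite /upd; case: eqP => //; lia.
- case/and4P=> j16 w1 tb w2 co r.
  have [ee1 fe1] := ex_expr t24 w1 r; set l := (X in code_at _ _ X) in co *.
  have sl : all straight l by rewrite !all_cat !straight_expr straight_addr.
  have r1 : related L s (exs m (expr_code t e1)).
    by apply: related_frame r _ => y hy; apply: fe1; lia.
  have [ea fa] := ex_addr24 j t24 tb r1; rewrite ee1 in ea.
  have r2 : related L s (exs (exs m (expr_code t e1)) (addr_code t j)).
    by apply: related_frame r1 _ => y hy; apply: fa; lia.
  have [ee2 fe2] := ex_expr (leqW t24) w2 r2.
  have em y : y < t \/ rawb <= y -> exs m l y = upd m (loc L j (eval L s e1)) (eval L s e2) y.
    move=> hy; rewrite !exs_cat /= /ex1 /= /upd ee2 fe2; last by left.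
    rewrite ea; case: eqP => // _; rewrite fe2; last by lia.
    by rewrite fa // fe1.
  exists (exs m l); split.
  + have [k hk ek] := reach_straight m sl co; exists k => //; apply: leq_trans hk _.
    rewrite !size_cat /=; have := size_expr_code t e1; have := size_expr_code t.+1 e2.
    rewrite /addr_code; case: ifP => _ /=; lia.
  + by apply: related_frame (related_seta _ _ j16 r) _ => y hy; apply: em; lia.
  + move=> y /andP[y1 y2]; rewrite em; last by lia.
    rewrite /upd; case: eqP => // e; have := loc_ge L j (eval L s e1); rewrite -e; lia.
- case/andP=> w1 w2 /code_at_cat[co1 co2] r.
  have [m1 [h1 r1 f1]] := IH1 _ _ _ _ t24 w1 co1 r.
  have [m2 [h2 r2 f2]] := IH2 _ _ _ _ t24 w2 co2 r1.
  exists m2; split=> //; last by move=> y hy; rewrite f2 ?f1.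
  by rewrite size_cat addnA; apply: reach_trans h1 h2.
- case/and3P=> we w1 w2 /code_at_cat[coe /code_at_cons[fz /code_at_cat[co1 /code_at_cons[fj co2]]]] r.
  have [ee fe] := ex_expr t24 we r.
  have he := reach_straight m (straight_expr t e) coe.
  have hz := reach_jz (exs m (expr_code t e)) fz; rewrite ee in hz.
  have hez := reach_trans (leqnn _) he hz.
  have re : related L s (exs m (expr_code t e)).
    by apply: related_frame r _ => y hy; apply: fe; lia.
  have se := size_expr_code t e.
  set l1 := cmd_code _ t c1 in co1 fj co2 hez fz hz *; set l2 := cmd_code _ t c2 in co2 fj hez *.
  case: ifP hez => e0 hez.
    have [m2 [h2 r2 f2]] := IH2 _ _ _ _ t24 w2 co2 re.
    exists m2; split=> //; last by move=> y hy; rewrite f2 // fe //; lia.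
    have -> : o + size (expr_code t e ++ IJz t (o + size (expr_code t e) + size l1).+2
      :: l1 ++ IJmp ((o + size (expr_code t e) + size l1).+2 + size l2) :: l2)
      = (o + size (expr_code t e) + size l1).+2 + size l2.
      by rewrite !size_cat /= size_cat /=; lia.
    by apply: reach_trans hez h2; lia.
  have [m1 [h1 r1 f1]] := IH1 _ _ _ _ t24 w1 co1 re.
  exists m1; split=> //; last by move=> y hy; rewrite f1 // fe //; lia.
  apply: reach_trans (reach_trans (leqnn _) hez h1) _; last first.
    have -> : o + size (expr_code t e ++ IJz t (o + size (expr_code t e) + size l1).+2
      :: l1 ++ IJmp ((o + size (expr_code t e) + size l1).+2 + size l2) :: l2)
      = (o + size (expr_code t e) + size l1).+2 + size l2.
      by rewrite !size_cat /= size_cat /=; lia.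
    exact: reach_jmp fj.
  lia.
- case/and3P=> x22 tb wc; set l := cmd_code (o + 5) t.+1 c.
  case/code_at_cons=> [f0 /code_at_cons[f1 /code_at_cons[f2 /code_at_cons[f3 /code_at_cons[f4]]]]].
  have o5 : o.+4.+1 = o + 5 by rewrite addnC.
  rewrite o5; case/code_at_cat=> [co1 /code_at_cons[f5 /code_at_cons[f6 /code_at_cons[f7 _]]]] r.
  have endE : o + (size (l ++ [:: IConst t.+1 1; IAdd t t t.+1; IJmp o.+1])).+4.+1
    = o + size l + 8 by rewrite size_cat /=; lia.
  rewrite endE.
  have ex p' o' m' i : fetch p' o' = i -> straight i -> reach p' o' m' o'.+1 (ex1 m' i) 1.
    by move=> fi si; exists 1; rewrite //= (step_straight _ fi si).
  (* Induction on the number [d] of remaining rounds, the counter being [i]; the 2 pays for the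
     last, failing test. *)
  have loop d : forall i s m, i + d = L -> m t = i -> related L s m ->
    exists m', [/\ reach p o.+1 m (o + size l + 8) m' (d * (cost L c + 7) + 2),
      related L (foldl (fun s i => run L c (setv s x i)) s (iota i d)) m'
      & forall y, 23 < y < t -> m' y = m y].
    elim: d => [|d IHd] i s' m' id mt r'.
      have h1 := ex _ _ m' _ f1 isT; have h2 := reach_jz (ex1 m' (ISub t.+1 1 t)) f2.
      have [_ m1 _ _] := r'.
      have et : ex1 m' (ISub t.+1 1 t) t.+1 = 0 by rewrite /ex1 /= /upd eqxx m1 mt -id addn0 subnn.
      rewrite et eqxx in h2.
      exists (ex1 m' (ISub t.+1 1 t)); split.
      + exact: reach_trans h1 h2.
      + by apply: related_frame r' _ => y hy; rewrite /ex1 /= /upd; case: eqP => //; lia.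
      + by move=> y hy; rewrite /ex1 /= /upd; case: eqP => //; lia.
    have h1 := ex _ _ m' _ f1 isT; have h2 := reach_jz (ex1 m' (ISub t.+1 1 t)) f2.
    have [_ m1 _ _] := r'.
    have et : ex1 m' (ISub t.+1 1 t) t.+1 == 0 = false.
      by rewrite /ex1 /= /upd eqxx m1 mt; lia.
    rewrite et in h2.
    have h3 := ex _ _ (ex1 m' (ISub t.+1 1 t)) _ f3 isT.
    have h4 := ex _ _ (ex1 (ex1 m' (ISub t.+1 1 t)) (IConst t.+1 0)) _ f4 isT.
    set m4 := ex1 _ (IAdd x.+2 t t.+1) in h4.
    have e4 y : y <= 23 \/ y <= t \/ rawb <= y -> m4 y = upd m' x.+2 i y.
      move=> hy; rewrite /m4 /ex1 /= /upd eqxx; case: (y =P x.+2) => [_|yx].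
        by rewrite !ifF ?mt ?addn0 //; lia.
      by case: eqP => //; lia.
    have r4 : related L (setv s' x i) m4.
      by apply: related_frame (related_setv _ x22 r') _ => y hy; apply: e4; lia.
    rewrite o5 in h4.
    have [m5 [h5 r5 e5]] := IH _ _ _ _ (leqW t24) wc co1 r4.
    have h6 := ex _ _ m5 _ f5 isT.
    have h7 := ex _ _ (ex1 m5 (IConst t.+1 1)) _ f6 isT.
    set m7 := ex1 _ (IAdd t t t.+1) in h7.
    have h8 := @reach_jmp _ _ _ m7 f7.
    have e7 y : y <= 23 \/ y < t \/ rawb <= y -> m7 y = m5 y.
      move=> hy; rewrite /m7 /ex1 /= /upd; case: eqP => [|_]; first by lia.
      by case: eqP => //; lia.
    have m7t : m7 t = i.+1.
      rewrite /m7 /ex1 /= /upd !eqxx; have -> : (t == t.+1) = false by lia.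
      rewrite e5; last by lia.
      by rewrite e4 /upd; [case: eqP => [|_]; lia | lia].
    have r7 : related L (run L c (setv s' x i)) m7.
      by apply: related_frame r5 _ => y hy; apply: e7; lia.
    have id' : i.+1 + d = L by lia.
    have [m9 [h9 r9 e9]] := IHd _ _ _ id' m7t r7.
    exists m9; split=> //.
    + apply: reach_trans (reach_trans (leqnn _) h1 h2) _; last first.
        apply: reach_trans (reach_trans (leqnn _) h3 h4) _; last first.
          apply: reach_trans h5 _; last first.
            apply: reach_trans (reach_trans (leqnn _) h6 h7) _; last first.
              exact: reach_trans (leqnn _) h8 h9.
            exact: leqnn.
          exact: leqnn.
        exact: leqnn.
      by rewrite mulSn; lia.
    + move=> y hy; rewrite e9 // e7; last by lia.
      rewrite e5; last by lia.
      by rewrite e4; [rewrite /upd; case: eqP => //; lia | lia].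
  have h0 := ex _ _ m _ f0 isT.
  have [|||m' [h' r' e']] := loop L 0 s (ex1 m (IConst t 0)).
  + by rewrite add0n.
  + by rewrite /ex1 /= /upd eqxx.
  + by apply: related_frame r _ => y hy; rewrite /ex1 /= /upd; case: eqP => //; lia.
  exists m'; split=> //.
  + by apply: reach_trans h0 h'; lia.
  + by move=> y hy; rewrite e' // /ex1 /= /upd; case: eqP => //; lia.
Qed.

(** * Sharing the low cells between registers, input and output *)

Lemma loc_lt16 L j i : j < 16 -> loc L j i = L + rawb.+1 + 16 * i + j.
Proof. by rewrite /loc; case: eqP => //; lia. Qed.

(** Rescues the input cells that lie in the register area, [m 1] holding the stride 16. Index 0 of
    array 0 corresponds to cell 2, just past the input length and the size of the ground set. *)
Fixpoint save k := if k is k'.+1 then save k' ++ [:: IStore 0 k'.+2; IAdd 0 0 1] else [::].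

Definition prologue k :=
  [:: IConst 1 rawb.+1; IAdd 0 0 1; IConst 1 16] ++ save k ++
  [:: IConst 1 (16 * k); ISub 0 0 1; IConst 1 rawb.+1; ISub 1 0 1].

(* The initial values of the variables are what the input left in their cells. *)
Definition init_store (w : seq nat) :=
  Store (fun x => nth 0 w x.+1)
    (fun j i => if j == 16 then nth 0 w (47 + i) else
       if (j == 0) && (i < 46) then nth 0 w i.+1 else 0).

Lemma ex_save L k m : k <= 46 -> m 0 = L + rawb.+1 -> m 1 = 16 ->
  [/\ exs m (save k) 0 = L + rawb.+1 + 16 * k, exs m (save k) 1 = 16,
    forall x, 1 < x < L + rawb.+1 -> exs m (save k) x = m x
  & forall j i, j < 16 ->
      exs m (save k) (loc L j i) = if (j == 0) && (i < k) then m i.+2 else m (loc L j i)].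
Proof.
move=> + m0 m1; elim: k => [|k IH] hk /=; first by split=> // [|j i _]; rewrite ?m0 ?addn0 ?andbF.
have [e0 e1 ex ej] := IH (ltnW hk); rewrite exs_cat /= /ex1 /= /upd e0.
have lk : L + rawb.+1 + 16 * k = loc L 0 k by rewrite loc_lt16 // addn0.
rewrite lk; have g := loc_ge L 0 k; rewrite /rawb in g.
have g' : L + 49 <= loc L 0 k by rewrite -lk /rawb; lia.
have n0 : (0 == loc L 0 k) = false by lia.
have n1 : (1 == loc L 0 k) = false by lia.
rewrite n0 n1 eqxx; split.
- by rewrite e1; lia.
- by [].
- move=> x hx; rewrite ifF; last by lia.
  by rewrite ifF ?ex //; move: hx; rewrite /rawb; lia.
- move=> j i hj; have gj := loc_ge L j i; rewrite /rawb in gj.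
  rewrite ifF; last by lia.
  rewrite loc_eq ?(ltnW hj) // /idx (ltn_eqF hj) /=.
  case: (j =P 0) => [->|nj] /=; last by rewrite ej //; case: eqP.
  case: (i =P k) => [->|ik]; first by rewrite ltnSn ex // /rawb; lia.
  by rewrite ej //=; have -> : (i < k.+1) = (i < k) by lia.
Qed.

Lemma ex_prologue (w : seq nat) k : k = 46 ->
  related (size w) (init_store w) (exs (Defs.mem (init_conf w)) (prologue k)).
Proof.
move=> k46.
set m := Defs.mem _; rewrite /prologue exs_cat [exs _ (save k ++ _)]exs_cat; set L := size w.
set m1 := exs m [:: _; _; _].
have hk : k <= 46 by rewrite k46.
have [||e0 e1 ex ej] := @ex_save L k m1 hk; [by []|by []|].
set m2 := exs m1 _ in e0 e1 ex ej *; clearbody m2.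
have mx x : x <> 0 -> x <> 1 -> m1 x = nth 0 w x.-1.
  by case: x => [|[|x]].
split.
- by rewrite /exs /= /ex1 /= /upd /= e0; lia.
- by rewrite /exs /= /ex1 /= /upd /= e0; lia.
- move=> x x22; rewrite /exs /= /ex1 /= /upd /= ex ?mx //.
  by rewrite /rawb; lia.
- move=> j i j16; have g := loc_ge L j i; rewrite /rawb in g.
  have n0 : loc L j i == 0 = false by lia.
  have n1 : loc L j i == 1 = false by lia.
  rewrite /exs /= /ex1 /= /upd /= n0 n1.
  case: (j =P 16) => [j16'|nj].
    rewrite ex; last first.
      by rewrite /loc j16' /rawb /=; lia.
    rewrite mx; try lia.
    rewrite /loc /idx j16' /=; congr nth; rewrite /rawb; lia.
  have jl : j < 16 by lia.
  rewrite ej // /idx (negbTE (introN eqP nj)); rewrite k46; case: ifP => [/andP[_ i46]|_].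
    by rewrite mx.
  rewrite mx; try lia.
  by rewrite nth_default // loc_lt16 // /rawb -/L; lia.
Qed.

Fixpoint load k := if k is k'.+1 then load k' ++ [:: ILoad k'.+2 0; IAdd 0 0 1] else [::].

(* Finally [m 0 = o] and [m 1 = m (loc 2 o)] where [o = m (loc 2 0)]; the last three
   instructions swap the cells 0 and 1. *)
Definition epilogue k :=
  [:: IConst 1 33; IAdd 0 0 1; IConst 1 16] ++ load k ++
  [:: IConst 1 (16 * k); ISub 0 0 1; IConst 1 31; ISub 0 0 1; ILoad 1 0] ++ nseq 16 (IAdd 0 0 1) ++
  [:: ILoad 0 0; IAdd 0 0 1; ISub 1 0 1; ISub 0 0 1].

Lemma ex_load k m : k <= 46 -> rawb <= m 0 -> m 1 = 16 ->
  [/\ exs m (load k) 0 = m 0 + 16 * k, exs m (load k) 1 = 16,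
    forall x, 1 < x < k.+2 -> exs m (load k) x = m (m 0 + 16 * (x - 2))
  & forall x, 1 < x -> k.+2 <= x -> exs m (load k) x = m x].
Proof.
move=> + m0 m1; elim: k => [|k IH] hk /=; first by split=> // [|x]; rewrite ?addn0; lia.
have [e0 e1 el eg] := IH (ltnW hk); rewrite exs_cat /= /ex1 /= /upd e0 e1.
have m48 : 47 < m 0 := m0.
split.
- by rewrite /=; lia.
- by [].
- move=> x hx; rewrite ifF; last by lia.
  case: eqP => [->|xk]; last by rewrite el //; lia.
  have -> : k.+2 - 2 = k by lia.
  by rewrite eg //; lia.
- move=> x h1 hx; rewrite !ifF ?eg //; lia.
Qed.

Lemma ex_add16 k m : exs m (nseq k (IAdd 0 0 1)) 0 = m 0 + k * m 1 /\
  forall x, x != 0 -> exs m (nseq k (IAdd 0 0 1)) x = m x.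
Proof.
elim: k m => [|k IH] m /=; first by rewrite addn0.
have [e0 ex] := IH (ex1 m (IAdd 0 0 1)); rewrite /exs /= -/(exs _ _).
rewrite e0; split; first by rewrite /ex1 /= /upd /=; lia.
by move=> x x0; rewrite ex // /ex1 /= /upd (negbTE x0).
Qed.

Lemma ex_head m : let m' := exs m [:: IConst 1 33; IAdd 0 0 1; IConst 1 16] in
  [/\ m' 0 = m 0 + 33, m' 1 = 16 & forall x, 1 < x -> m' x = m x].
Proof. by rewrite /exs /= /ex1 /= /upd /=; split=> // -[|[|x]]. Qed.

Lemma ex_middle m v :
  let m' := exs m [:: IConst 1 v; ISub 0 0 1; IConst 1 31; ISub 0 0 1; ILoad 1 0] in
  [/\ m' 0 = m 0 - v - 31, 1 < m 0 - v - 31 -> m' 1 = m (m 0 - v - 31)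
    & forall x, 1 < x -> m' x = m x].
Proof.
rewrite /exs /= /ex1 /= /upd /=; split=> // [h|]; last by case=> [|[|x]].
by rewrite !ifF //; lia.
Qed.

Lemma ex_swap m : let m' := exs m [:: ILoad 0 0; IAdd 0 0 1; ISub 1 0 1; ISub 0 0 1] in
  [/\ m' 0 = m 1, m' 1 = m (m 0) & forall x, 1 < x -> m' x = m x].
Proof.
rewrite /exs /= /ex1 /= /upd /=; split; [lia | lia | by case=> [|[|x]]].
Qed.

(** Once [load] is done, only the cells 0 and 1 are left as scratch space. The value due in cell 1
    is therefore kept at index [o] of array 2, where [o] is the value due in cell 0: its address can
    be computed from [o] alone, and one swap finishes. *)
Lemma ex_epilogue L s m k : k = 46 -> related L s m -> let m' := exs m (epilogue k) in
  [/\ m' 0 = ar s 2 0, m' 1 = ar s 2 (ar s 2 0),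
    forall x, 1 < x < rawb -> m' x = ar s 1 x
  & forall x, rawb <= x -> m' x = m x].
Proof.
move=> k46 [m0 m1 _ ha]; rewrite /epilogue exs_cat [exs _ (load k ++ _)]exs_cat.
rewrite [exs _ (_ ++ nseq _ _ ++ _)]exs_cat [exs _ (nseq _ _ ++ _)]exs_cat.
have [a0 a1 ax] := ex_head m; set a := exs m _ in a0 a1 ax *; clearbody a.
(* The constant 33 is 16 * 2 + 1, the offset of index 2 in array 1. *)
have {}a0 : a 0 = loc L 1 2 by rewrite a0 m0 loc_lt16 // /rawb; lia.
have hk : k <= 46 by rewrite k46.
have [||b0 b1 bl bg] := @ex_load k a hk; [by rewrite a0 loc_ge|by []|].
set b := exs a _ in b0 b1 bl bg *; clearbody b.
have [c0 c1 cx] := ex_middle b (16 * k); set c := exs b _ in c0 c1 cx *; clearbody c.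
(* Subtracting 31 leads from offset 33 to offset 2, that is index 0 of array 2. *)
have bE : b 0 - 16 * k - 31 = loc L 2 0.
  by rewrite b0 a0 !loc_lt16 // /rawb; lia.
rewrite {}bE in c0 c1; have g := loc_ge L 2 0; rewrite /rawb in g.
have {}c1 : c 1 = ar s 2 0 by rewrite c1 ?bg ?ax ?ha //; lia.
have [d0 dx] := ex_add16 16 c; set d := exs c _ in d0 dx *; clearbody d.
have dE : d 0 = loc L 2 (ar s 2 0).
  by rewrite d0 c0 c1 !loc_lt16 //; lia.
have g2 := loc_ge L 2 (ar s 2 0); rewrite /rawb in g2.
have [e0 e1 ex] := ex_swap d; set e := exs d _ in e0 e1 ex *; clearbody e.
split.
- by rewrite e0 dx.
- rewrite e1 dE dx; last by lia.
  by rewrite cx ?bg ?ax ?ha //; lia.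
- move=> x hx; have hx' : 1 < x < 48 := hx; rewrite ex; last by lia.
  rewrite dx; last by lia.
  rewrite cx ?bl ?a0; try lia.
  rewrite ax; last by rewrite loc_lt16 // /rawb; lia.
  rewrite -[RHS]ha //; congr m; rewrite !loc_lt16 //; lia.
- rewrite /rawb => x hx; rewrite ex; last by lia.
  rewrite dx; last by lia.
  by rewrite cx ?bg ?ax //; lia.
Qed.

Lemma straight_save k : all straight (save k).
Proof. by elim: k => //= k; rewrite all_cat => ->. Qed.

Lemma straight_load k : all straight (load k).
Proof. by elim: k => //= k; rewrite all_cat => ->. Qed.

Lemma straight_prologue k : all straight (prologue k).
Proof. by rewrite all_cat [all _ (save k ++ _)]all_cat straight_save. Qed.

Lemma straight_epilogue k : all straight (epilogue k).
Proof. by rewrite all_cat [all _ (load k ++ _)]all_cat straight_load. Qed.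

Definition program_of k c :=
  let l := cmd_code (size (prologue k)) 24 c in prologue k ++ l ++ epilogue k.

Lemma program_of_correct k c w (s := run (size w) c (init_store w)) :
  k = 46 -> wf_cmd 24 c ->
  ar s 2 0 <= size w -> 0 < ar s 2 0 -> ar s 2 (ar s 2 0) = ar s 1 1 ->
  (forall i, rawb <= i <= ar s 2 0 -> ar s 16 (i - rawb) = ar s 1 i) ->
  exists t, t <= cost (size w) c + (size (prologue k) + size (epilogue k)) /\
    halts_in (program_of k c) w t (eq [seq ar s 1 i | i <- iota 1 (ar s 2 0)]).
Proof.
move=> k46 wc oL o1 c1 hraw; set p := program_of k c.
have co : code_at p 0 p by move=> i _.
have [cop /code_at_cat[coc coe]] := code_at_cat co.
have h1 := reach_straight (Defs.mem (init_conf w)) (straight_prologue k) cop.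
have [m2 [h2 r2 _]] := cmd_correct (isT : 23 < 24) wc coc (ex_prologue w k46).
have h3 := reach_straight m2 (straight_epilogue k) coe.
have [t ht et] := reach_trans (leqnn _) (reach_trans (leqnn _) h1 h2) h3.
exists t; split; first by lia.
rewrite /halts_in [iter t _ _]et; split.
  (* The run falls off the end of the program, where the default of [fetch] is [IHalt]. *)
  rewrite /is_halted /fetch nth_default //.
  set x := size _ in coe *; set y := size _ in coe *; set z := size (epilogue k).
  suff: size p <= 0 + x + y + z by [].
  rewrite /p /program_of [size _]size_cat [size (_ ++ epilogue k)]size_cat.
  by rewrite add0n addnA.
have [e0 e1 el eg] := ex_epilogue k46 r2; rewrite -/s in e0 e1 el eg r2.
set M := exs m2 _ in e0 e1 el eg *; clearbody M.
rewrite /output /= e0; apply/eq_in_map => i; rewrite mem_iota => hi.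
(* Cell 1 comes from the swap, the other low cells from [load], the rest from array 16. *)
have [i1|[i2|i3]] : i = 1 \/ 1 < i < rawb \/ rawb <= i by rewrite /rawb; lia.
- by rewrite i1 e1.
- by rewrite el.
rewrite eg // -hraw; last by lia.
have ea : i = loc (size w) 16 (i - rawb) by rewrite /loc /= ; lia.
case: r2 => _ _ _ ha; rewrite [in RHS]ea ha // /idx /=; congr (ar s 16); lia.
Qed.

(** * Reasoning about programs *)

(** [wv] and [wa] list the variables and arrays that a command may write; on concrete programs
    membership is decided by computation, which discharges the frame conditions. *)
Fixpoint wv c : seq nat :=
  match c with
  | Assign x _ => [:: x]
  | Seq c1 c2 | If _ c1 c2 => wv c1 ++ wv c2
  | Loop x c => x :: wv c
  | _ => [::]
  end.

Fixpoint wa c : seq nat :=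
  match c with
  | Put j _ _ => [:: j]
  | Seq c1 c2 | If _ c1 c2 => wa c1 ++ wa c2
  | Loop _ c => wa c
  | _ => [::]
  end.

Definition same_outside c s s' :=
  (forall y, y \notin wv c -> va s' y = va s y) /\
  (forall j i, j \notin wa c -> ar s' j i = ar s j i).

Lemma run_same L c s : same_outside c s (run L c s).
Proof.
elim: c s => [|x e|k e1 e2|c1 IH1 c2 IH2|e c1 IH1 c2 IH2|x c IH] s; split=> //=.
- by move=> y; rewrite inE => /negbTE ->.
- by move=> j i; rewrite inE => /negbTE ->.
- by move=> y; rewrite mem_cat => /norP[y1 y2]; rewrite (IH2 _).1 ?(IH1 _).1.
- by move=> y i; rewrite mem_cat => /norP[y1 y2]; rewrite (IH2 _).2 ?(IH1 _).2.
- by move=> y; rewrite mem_cat => /norP[y1 y2]; case: ifP; rewrite ?(IH2 _).1 ?(IH1 _).1.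
- by move=> y i; rewrite mem_cat => /norP[y1 y2]; case: ifP; rewrite ?(IH2 _).2 ?(IH1 _).2.
- move=> y; rewrite inE => /norP[yx yc]; elim: (iota 0 L) s => //= i l IHl s.
  by rewrite IHl (IH _).1 //= (negbTE yx).
- by move=> y j yc; elim: (iota 0 L) s => //= i l IHl s; rewrite IHl (IH _).2.
Qed.

Lemma run_va L c s y : y \notin wv c -> va (run L c s) y = va s y.
Proof. exact: (run_same L c s).1. Qed.

Lemma run_ar L c s j i : j \notin wa c -> ar (run L c s) j i = ar s j i.
Proof. exact: (run_same L c s).2. Qed.

(** [Inv] has to be indifferent to the loop variable, which is overwritten at the start of every
    round. *)
Lemma run_loop L x c s (Inv : nat -> store -> Prop) :
  Inv 0 s ->
  (forall i s' w, Inv i s' -> Inv i (setv s' x w)) ->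
  (forall i s', i < L -> va s' x = i -> same_outside (Loop x c) s s' ->
     Inv i s' -> Inv i.+1 (run L c s')) ->
  Inv L (run L (Loop x c) s).
Proof.
move=> I0 Ix Is /=.
suff: forall k, k <= L -> let s' := foldl (fun s i => run L c (setv s x i)) s (iota 0 k) in
    Inv k s' /\ same_outside (Loop x c) s s' by case/(_ L (leqnn L)).
elim=> [|k IH] kL; first by split.
have [Ik sk] := IH (ltnW kL).
rewrite -[k.+1]addn1 iotaD foldl_cat add0n /=; move: (foldl _ _ _) Ik sk => s' Ik sk.
have sx : same_outside (Loop x c) s (setv s' x k).
  split=> [y yx|j i ji] /=; last exact: sk.2.
  by rewrite ifF ?sk.1 //; move: yx; rewrite inE => /norP[/negbTE].
rewrite addn1; split; first by apply: Is => //; [rewrite /= eqxx | exact: Ix].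
split=> [y yx|j i ji]; last by rewrite run_ar // sx.2.
by rewrite run_va ?sx.1 //; move: yx; rewrite inE => /norP[].
Qed.

(** Every loop makes [L] rounds; those from the bound [b] on are idle. *)
Definition For x b c := Loop x (If (Minus (V b) (V x)) c Skip).

Lemma run_for L x b c s (Inv : nat -> store -> Prop) :
  va s b <= L -> b \notin wv (For x b c) ->
  Inv 0 s ->
  (forall i s' w, Inv i s' -> Inv i (setv s' x w)) ->
  (forall i s', i < va s b -> va s' x = i -> same_outside (For x b c) s s' ->
     Inv i s' -> Inv i.+1 (run L c s')) ->
  Inv (va s b) (run L (For x b c) s).
Proof.
move=> bL bw I0 Ix Is.
have := @run_loop L x (If (Minus (V b) (V x)) c Skip) s
  (fun i s' => Inv (minn i (va s b)) s').
rewrite (minn_idPr bL) min0n; apply=> // [i s' w|i s' iL xi sm]; first exact: Ix.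
have eb : va s' b = va s b by apply: sm.1.
rewrite /= xi eb; case: ifP => [si|si].
  by have [-> ->] : minn i (va s b) = va s b /\ minn i.+1 (va s b) = va s b by lia.
have [-> ->] : minn i (va s b) = i /\ minn i.+1 (va s b) = i.+1 by lia.
apply: Is => //; lia.
Qed.

Lemma iotaSr a k : iota a k.+1 = rcons (iota a k) (a + k).
Proof. by rewrite -addn1 iotaD cats1. Qed.

Lemma eq_map_iota (S : Type) (f g : nat -> S) a k : (forall i, a <= i < a + k -> f i = g i) ->
  map f (iota a k) = map g (iota a k).
Proof. by move=> h; apply/eq_in_map => i; rewrite mem_iota => /h. Qed.

Definition eqe a b := Plus (Minus a b) (Minus b a).
Definition IfZ e c := If e Skip c.
Definition IfN e c := If e c Skip.
Definition IfEq a b c := IfZ (eqe a b) c.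
Definition Inc x := Assign x (Plus (V x) (N 1)).

Lemma run_IfZ L e c s : run L (IfZ e c) s = if eval L s e == 0 then run L c s else s.
Proof. by []. Qed.

Lemma run_IfN L e c s : run L (IfN e c) s = if eval L s e == 0 then s else run L c s.
Proof. by []. Qed.

Lemma eqe0 a b : (a - b + (b - a) == 0) = (a == b).
Proof. lia. Qed.

Lemma run_seq L c1 c2 s : run L (Seq c1 c2) s = run L c2 (run L c1 s).
Proof. by []. Qed.

(* [vM] is the number of rules and [vT] the total size of their bodies, whose elements,
   the occurrences, are numbered consecutively.  Arrays: 0 input, 1 output (from index 1),
   2 end of the output, 3 and 4 element and rule of an occurrence, 5 head of a rule,
   6 previous occurrence of the same element, 7 last occurrence of an element (both
   shifted by one, 0 meaning none), 8 rule is hit, 9 number of reasons for an element not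
   to be in the closure, 10 occurrence was queued, 11 queue of occurrences, 12 number of
   unhit rules for the current head containing an element. *)
Definition vM := 0. Definition vT := 1. Definition vI := 2. Definition vP := 3.
Definition vJ := 4. Definition vK := 5. Definition vtail := 6. Definition vq := 7.
Definition vok := 8. Definition vz := 9. Definition vO := 10. Definition vC := 11.
Definition vpos := 12. Definition vsz := 13. Definition vt := 14. Definition vszpos := 16.

Definition chain :=
  For vP vT (Seq (Put 6 (V vP) (Get 7 (Get 3 (V vP))))
                 (Put 7 (Get 3 (V vP)) (Plus (V vP) (N 1)))).

(* The successor of the last [p < k] with [el p = y], or [0] if there is none. *)
Fixpoint lo (el : nat -> nat) y k :=
  if k is k'.+1 then if el k' == y then k else lo el y k' else 0.

Lemma chainP L s (el := ar s 3) : va s vT <= L -> (forall y, ar s 7 y = 0) ->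
  let s' := run L chain s in
  (forall p, p < va s vT -> ar s' 6 p = lo el (el p) p) /\
  (forall y, ar s' 7 y = lo el y (va s vT)).
Proof.
move=> TL z7; apply: (@run_for _ _ _ _ _ (fun i s' =>
  (forall p, p < i -> ar s' 6 p = lo el (el p) p) /\ (forall y, ar s' 7 y = lo el y i))) => //.
move=> i s' iT xi sm [h6 h7]; have e3 p : ar s' 3 p = el p by apply: sm.2.
rewrite /= xi !e3; split=> [p pi|y] /=.
  case: (p =P i) => [->|np]; first by rewrite h7.
  by rewrite h6 //; lia.
by rewrite addn1 h7 eq_sym.
Qed.

(** * Parsing *)

(** The prologue has filled array 0 below index 46. Index [i] from 46 on is the input entry [i + 1],
    found at index [i - 46] of array 16. *)
Definition norm :=
  Loop vP (IfN (Minus (V vP) (N 45)) (Put 0 (V vP) (Get 16 (Minus (V vP) (N 46))))).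

Lemma normP w i : i < (size w).-1 ->
  ar (run (size w) norm (init_store w)) 0 i = nth 0 w i.+1.
Proof.
move=> iL; set L := size w in iL *.
have := @run_loop L vP (IfN (Minus (V vP) (N 45)) (Put 0 (V vP) (Get 16 (Minus (V vP) (N 46)))))
 (init_store w) (fun i s' => forall k, k < L.-1 -> k < 46 \/ k < i -> ar s' 0 k = nth 0 w k.+1).
move=> H; refine (H _ _ _ i iL _); last by lia.
- by move=> k kL [k46|//]; rewrite /= k46.
- by [].
move=> {iL}i s' iL xi sm h k kL hk; rewrite /= xi.
case: ifP => [i45|i45]; first by apply: h => //; lia.
rewrite /=; case: (k =P i) => [ki|ki]; last by apply: h => //; lia.
rewrite sm.2 // /idx /=; congr nth; rewrite /rawb; lia.
Qed.

Definition enc_pair (x : seq nat * nat) := [:: x.2, size x.1 & x.1].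

(** The occurrences in input order, as pairs of a rule number and an element. *)
Definition pairs (G : seq (seq nat * nat)) i :=
  flatten [seq [seq (j, e) | e <- (nth ([::], 0) G j).1] | j <- iota 0 i].

Definition pair_of s p := (ar s 4 p, ar s 3 p).

Definition parse_elem :=
  Seq (Put 3 (V vT) (Get 0 (V vpos))) (Seq (Put 4 (V vT) (V vI)) (Seq (Inc vT) (Inc vpos))).

Definition parse_rule :=
  Seq (Put 5 (V vI) (Get 0 (V vpos)))
  (Seq (Assign vsz (Get 0 (Plus (V vpos) (N 1))))
  (Seq (Assign vpos (Plus (V vpos) (N 2))) (For vt vsz parse_elem))).

Definition parse :=
  Seq (Assign vM (Get 0 (N 0))) (Seq (Assign vpos (N 1)) (Seq (Assign vT (N 0))
  (For vI vM parse_rule))).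

Lemma parse_elemsP L s l :
  va s vsz = size l -> size l <= L ->
  (forall t, t < size l -> ar s 0 (va s vpos + t) = nth 0 l t) ->
  let s' := run L (For vt vsz parse_elem) s in
  [/\ va s' vT = va s vT + size l, va s' vpos = va s vpos + size l &
   map (pair_of s') (iota 0 (va s' vT))
   = map (pair_of s) (iota 0 (va s vT)) ++ [seq (va s vI, e) | e <- l]].
Proof.
move=> szE lL hl.
have := @run_for L vt vsz parse_elem s (fun i s' =>
  [/\ va s' vT = va s vT + i, va s' vpos = va s vpos + i &
   map (pair_of s') (iota 0 (va s' vT))
   = map (pair_of s) (iota 0 (va s vT)) ++ [seq (va s vI, e) | e <- take i l]]).
rewrite szE take_size; apply=> //.
- by rewrite take0 cats0 !addn0.
- move=> i s' il ti sm [hT hp hm]; have I' : va s' vI = va s vI by apply: sm.1.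
  have a0 k : ar s' 0 k = ar s 0 k by apply: sm.2.
  rewrite /= hT hp; split; try by rewrite addn1 addnS.
  rewrite addn1 iotaSr map_rcons add0n (take_nth 0 il) map_rcons -rcons_cat -hm hT.
  congr rcons; last by rewrite /pair_of /= !eqxx I' a0 hl.
  by apply: eq_map_iota => k hk; rewrite /pair_of /= /idx /= !ifF //; lia.
Qed.

Lemma parseP L s (G : seq (seq nat * nat)) (W := size G :: flatten (map enc_pair G)) :
  size W <= L -> (forall k, k < size W -> ar s 0 k = nth 0 W k) ->
  let s' := run L parse s in
  [/\ va s' vM = size G, va s' vT = size (pairs G (size G)),
    map (pair_of s') (iota 0 (va s' vT)) = pairs G (size G) &
    forall j, j < size G -> ar s' 5 j = (nth ([::], 0) G j).2].
Proof.
move=> WL hW; rewrite /parse !run_seq; set s1 := run L (Assign vT _) _.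
have [M1 p1 T1] : [/\ va s1 vM = size G, va s1 vpos = 1 & va s1 vT = 0].
  by split=> //; rewrite /s1 /= hW.
have a1 k : k < size W -> ar s1 0 k = nth 0 W k by exact: hW.
move: (s1) M1 p1 T1 a1 => {s1}s1 M1 p1 T1 a1.
have GL : size G <= L.
  apply: leq_trans WL; rewrite /W /= leqW // size_flatten /shape -map_comp.
  by elim: (G) => //= x G' IH; lia.
have := @run_for L vI vM parse_rule s1 (fun i s' =>
  [/\ va s' vpos = (size (flatten (map enc_pair (take i G)))).+1,
   va s' vT = size (pairs G i),
    map (pair_of s') (iota 0 (va s' vT)) = pairs G i &
    forall j, j < i -> ar s' 5 j = (nth ([::], 0) G j).2]).
rewrite M1; case=> // [|i s' iG Ii sm [hp hT hm h5]|hp hT hm h5]; last first.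
  by split=> //; rewrite run_va.
  have a0 k : k < size W -> ar s' 0 k = nth 0 W k by move=> kW; rewrite sm.2 // a1.
  set x := nth ([::], 0) G i.
  (* The input is cut around rule [i], so that the reading position is the length of the prefix. *)
  have WE : W = (size G :: flatten (map enc_pair (take i G))) ++ enc_pair x
                 ++ flatten (map enc_pair (drop i.+1 G)).
    rewrite /W -{2}(cat_take_drop i G) map_cat flatten_cat /=.
    by rewrite (drop_nth ([::], 0) iG).
  set f := size G :: _ in WE; have pf : va s' vpos = size f by rewrite hp.
  have aE k : k < size (enc_pair x) -> ar s' 0 (va s' vpos + k) = nth 0 (enc_pair x) k.
    move=> kx; rewrite pf a0 WE; last by rewrite !size_cat; lia.
    by rewrite nth_cat ltnNge leq_addr addKn nth_cat kx.
  rewrite /parse_rule !run_seq; set s2 := run L (Assign vpos _) _.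
  have [sz2 p2 T2 I2] : [/\ va s2 vsz = size x.1, va s2 vpos = va s' vpos + 2,
      va s2 vT = va s' vT & va s2 vI = i].
    by split=> //; rewrite /s2 /= (aE 1).
  have a2 k : ar s2 0 k = ar s' 0 k by [].
  have p52 j : j <= i -> ar s2 5 j = (nth ([::], 0) G j).2.
    rewrite /s2 /= Ii leq_eqVlt; case: eqP => [-> _|_ /=]; last exact: h5.
    by have := aE 0 isT; rewrite addn0.
  have m2 : map (pair_of s2) =1 map (pair_of s') by [].
  move: (s2) sz2 p2 T2 I2 a2 p52 m2 => {s2}s2 sz2 p2 T2 I2 a2 p52 m2.
  have [||qT qp qm] := parse_elemsP (l := x.1) (L := L) sz2.
  + apply: leq_trans WL; rewrite WE !size_cat /=; lia.
  + by move=> t tx; rewrite p2 a2 -addnA (aE (2 + t)).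
  split.
  + rewrite qp p2 hp (take_nth ([::], 0) iG) map_rcons flatten_rcons size_cat -/x /=; lia.
  + by rewrite qT T2 hT /pairs iotaSr map_rcons flatten_rcons size_cat size_map add0n.
  + by rewrite qm m2 T2 hm I2 /pairs iotaSr map_rcons flatten_rcons add0n.
  + by move=> j ji; rewrite run_ar // p52.
by split; rewrite ?take0 //= T1.
Qed.

(** * Processing one rule *)

(** Counters indexed by elements are cleared by way of the occurrences and heads, never by a sweep
    of the ground set, whose size is not bounded by the input. *)
Definition reset :=
  Seq (For vP vT (Seq (Put 10 (V vP) (N 0))
        (Seq (Put 9 (Get 3 (V vP)) (N 0)) (Put 12 (Get 3 (V vP)) (N 0)))))
      (For vJ vM (Seq (Put 8 (V vJ) (N 0)) (Put 9 (Get 5 (V vJ)) (N 0)))).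

Definition mark_trivial :=
  For vP vT (IfEq (Get 3 (V vP)) (Get 5 (Get 4 (V vP))) (Put 8 (Get 4 (V vP)) (N 1))).

Definition count_rules :=
  For vJ vM (IfZ (Get 8 (V vJ)) (Put 9 (Get 5 (V vJ)) (Plus (Get 9 (Get 5 (V vJ))) (N 1)))).

(* The elements that must be avoided get an additional count that is never removed. *)
Definition block :=
  Seq (Put 9 (V vq) (Plus (Get 9 (V vq)) (N 1)))
      (For vP vT (IfEq (Get 4 (V vP)) (V vI)
        (Put 9 (Get 3 (V vP)) (Plus (Get 9 (Get 3 (V vP))) (N 1))))).

(** The argument is an occurrence shifted by one, and 0 does nothing. The flags in array 10 admit
    each occurrence once, so [T] rounds of [bfs] serve the whole queue. *)
Definition push e :=
  Seq (Assign vz e) (IfN (V vz) (Seq (Assign vz (Minus (V vz) (N 1)))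
    (IfZ (Get 10 (V vz))
      (Seq (Put 10 (V vz) (N 1)) (Seq (Put 11 (V vtail) (V vz)) (Inc vtail)))))).

Definition start :=
  Seq (Assign vtail (N 0)) (For vP vT (IfZ (Get 9 (Get 3 (V vP))) (push (Plus (V vP) (N 1))))).

Definition fire :=
  Seq (Put 8 (V vJ) (N 1))
  (Seq (Put 9 (Get 5 (V vJ)) (Minus (Get 9 (Get 5 (V vJ))) (N 1)))
       (IfZ (Get 9 (Get 5 (V vJ))) (push (Get 7 (Get 5 (V vJ)))))).

(** The chain of an element is followed lazily: visiting an occurrence queues its predecessor. Each
    round thus does bounded work and needs no inner loop. *)
Definition visit :=
  Seq (Assign vP (Get 11 (V vK))) (Seq (Assign vJ (Get 4 (V vP)))
  (Seq (IfZ (Get 8 (V vJ)) fire) (push (Get 6 (V vP))))).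

Definition bfs := For vK vT (IfN (Minus (V vtail) (V vK)) visit).

Definition verdict :=
  Seq (Assign vok (Minus (N 1) (Get 8 (V vI))))
      (For vJ vM (IfN (Minus (V vI) (V vJ)) (IfEq (Get 5 (V vJ)) (V vq)
        (IfZ (Get 8 (V vJ)) (Assign vok (N 0)))))).

Definition tally_unhit :=
  For vP vT (IfEq (Get 5 (Get 4 (V vP))) (V vq) (IfZ (Get 8 (Get 4 (V vP)))
    (Put 12 (Get 3 (V vP)) (Plus (Get 12 (Get 3 (V vP))) (N 1))))).

(** When rule [vI] is unhit, [block] leaves a free body element with count exactly 1, and the count
    of the head exceeds its number of unhit rules by 1. The tested equality thus says that all unhit
    rules for the head contain the element. *)
Definition check :=
  For vP vT (IfEq (Get 4 (V vP)) (V vI) (IfEq (Get 9 (Get 3 (V vP))) (N 1)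
    (IfN (eqe (Plus (Get 12 (Get 3 (V vP))) (N 1)) (Get 9 (V vq))) (Assign vok (N 0))))).

Definition emit_tails :=
  For vP vT (IfEq (Get 4 (V vP)) (V vI) (IfEq (Get 9 (Get 3 (V vP))) (N 1)
    (Seq (Put 1 (V vO) (Get 3 (V vP))) (Inc vO)))).

Definition emit :=
  Seq (Put 1 (V vO) (V vq))
  (Seq (Assign vszpos (Plus (V vO) (N 1)))
  (Seq (Assign vO (Plus (V vO) (N 2)))
  (Seq emit_tails
  (Seq (Put 1 (V vszpos) (Minus (Minus (V vO) (V vszpos)) (N 1))) (Inc vC))))).

(** Index 1 is reserved for the number of rules, known only at the end. *)
Definition outs s := [seq ar s 1 k | k <- iota 2 (va s vO - 2)].

Lemma run_IfEq L a b c s :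
  run L (IfEq a b c) s = if eval L s a == eval L s b then run L c s else s.
Proof. by rewrite run_IfZ /= eqe0. Qed.

(** The effect of [push] on the queue seen as a list. *)
Definition addq v (l : seq nat) := if (v == 0) || (v.-1 \in l) then l else rcons l v.-1.

Lemma mem_addq v l z : (z \in addq v l) = (z \in l) || (v != 0) && (z == v.-1).
Proof.
rewrite /addq; case: eqP => //= [_|_]; first by rewrite orbF.
case: ifP => [vl|_]; last by rewrite mem_rcons inE orbC.
by case: eqP => [->|]; rewrite ?vl ?orbF.
Qed.

Lemma take_addq k v l : k <= size l -> take k (addq v l) = take k l.
Proof.
by rewrite /addq; case: ifP => // _ kl; rewrite -cats1 takel_cat.
Qed.

Lemma size_addq v l : size l <= size (addq v l).
Proof. by rewrite /addq; case: ifP => // _; rewrite size_rcons leqW. Qed.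

Lemma lo_some E y k p : lo E y k = p.+1 -> p < k /\ E p = y.
Proof.
elim: k => //= k IH; case: eqP => [ek [<-]|_ /IH[pk ->]]; first by rewrite ltnS.
by rewrite leqW.
Qed.

Lemma lo_le E y k : lo E y k <= k.
Proof. by elim: k => //= k IH; case: eqP => // _; apply: leqW. Qed.

(** The chain of [y] runs from its last occurrence down to its first, and no step leaves [l]. *)
Lemma lo_closed E y k (l : seq nat) :
  (forall p, lo E y k = p.+1 -> p \in l) ->
  (forall p p', p \in l -> E p = y -> lo E y p = p'.+1 -> p' \in l) ->
  forall p, p < k -> E p = y -> p \in l.
Proof.
move=> h0 hs; elim: k h0 => //= k IH; case: eqP => [ek|nk] h0 p pk ep.
  have kl := h0 k erefl.
  move: pk; rewrite ltnS leq_eqVlt => /orP[/eqP->//|pk].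
  by apply: IH => // p' /(hs _ _ kl ek).
by apply: IH => //; move: pk; rewrite ltnS leq_eqVlt => /orP[/eqP pk|//]; rewrite -pk ep in nk.
Qed.

Lemma count_remove (a a' : pred nat) j s : uniq s -> j \in s -> a j -> ~~ a' j ->
  (forall i, i != j -> a i = a' i) -> count a s = (count a' s).+1.
Proof.
move=> us js aj aj' h; rewrite !(permP (perm_to_rem js)) /= aj (negbTE aj') add1n add0n.
by congr _.+1; apply: eq_in_count => i; rewrite mem_rem_uniq // inE => /andP[/h].
Qed.

(** * Correctness of the phases, in terms of occurrences *)

Section Phases.
Variables (L M T : nat) (E RL H NX LA : nat -> nat).
Hypotheses (ML : M <= L) (TL : T <= L) (RLM : forall p, p < T -> RL p < M).

Definition base s :=
  (va s vM = M /\ va s vT = T) /\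
  [/\ forall p, ar s 3 p = E p, forall p, ar s 4 p = RL p, forall j, ar s 5 j = H j,
    forall p, ar s 6 p = NX p & forall y, ar s 7 y = LA y].

Lemma base_same c s s' : same_outside c s s' ->
  all (fun x => x \notin wv c) [:: vM; vT] && all (fun j => j \notin wa c) [:: 3; 4; 5; 6; 7] ->
  base s -> base s'.
Proof.
case=> hv ha /= /and5P[/andP[m /andP[t _]] a3 a4 a5 /and3P[a6 a7 _]] [[hm ht] [h3 h4 h5 h6 h7]].
by split; split=> *; rewrite ?hv ?ha.
Qed.

Lemma base_run c s :
  all (fun x => x \notin wv c) [:: vM; vT] && all (fun j => j \notin wa c) [:: 3; 4; 5; 6; 7] ->
  base s -> base (run L c s).
Proof. exact: base_same (run_same L c s). Qed.

(** Array 9 is meaningful at these elements only. *)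
Definition relevant y :=
  has (fun p => E p == y) (iota 0 T) || has (fun j => H j == y) (iota 0 M).

Lemma relevantE p : p < T -> relevant (E p).
Proof. by move=> pT; apply/orP; left; apply/hasP; exists p; rewrite ?mem_iota. Qed.

Lemma relevantH j : j < M -> relevant (H j).
Proof. by move=> pT; apply/orP; right; apply/hasP; exists j; rewrite ?mem_iota. Qed.

Lemma resetP s : base s -> let s' := run L reset s in
  [/\ forall p, p < T -> ar s' 10 p = 0, forall p, p < T -> ar s' 12 (E p) = 0,
    forall j, j < M -> ar s' 8 j = 0 & forall y, relevant y -> ar s' 9 y = 0].
Proof.
move=> bs; rewrite /reset run_seq; set s1 := run L (For vP _ _) s.
have [f1 [c1 d1]] : (forall p, p < T -> ar s1 10 p = 0) /\
    ((forall p, p < T -> ar s1 9 (E p) = 0) /\ (forall p, p < T -> ar s1 12 (E p) = 0)).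
  case: (bs) => [[_ Tv] _]; rewrite -{}Tv; apply: (@run_for L vP vT _ s (fun i s' =>
    (forall p, p < i -> ar s' 10 p = 0) /\
    ((forall p, p < i -> ar s' 9 (E p) = 0) /\ (forall p, p < i -> ar s' 12 (E p) = 0)))) => //.
    by case: bs => [[_ ->] _].
  move=> i s' iT xi sm [h1 [h2 h3]]; have [_ [e3 _ _ _ _]] := base_same sm isT bs.
  split; last split; move=> p pi; rewrite /= xi /idx /= ?e3; case: eqP => // np.
  - by apply: h1; lia.
  - by apply: h2; case: (p =P i) np => [->//|]; lia.
  - by apply: h3; case: (p =P i) np => [->//|]; lia.
have b1 : base s1 by apply: base_run bs.
move: s1 f1 c1 d1 b1 => s1 f1 c1 d1 b1.
case: (b1) => [[Mv _] _]; have := @run_for L vJ vM (Seq (Put 8 (V vJ) (N 0)) (Put 9 (Get 5 (V vJ)) (N 0))) s1 (fun i s' =>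
    (forall j, j < i -> ar s' 8 j = 0) /\
    (forall y, has (fun p => E p == y) (iota 0 T) || has (fun j => H j == y) (iota 0 i)
        -> ar s' 9 y = 0)).
rewrite Mv; case=> // [|i s' iT xi sm [h1 h2]|h1 h2].
- split=> // y; rewrite orbF => /hasP[p]; rewrite mem_iota => /andP[_ pT] /eqP <-.
  exact: c1.
- have [_ [_ _ e5 _ _]] := base_same sm isT b1.
  split=> [j ji|y].
    by rewrite /= xi /idx /=; case: eqP => // np; apply: h1; lia.
  rewrite iotaSr has_rcons add0n /= xi /idx /= e5 eq_sym; case: eqP => //= _; exact: h2.
split=> // p pT; rewrite run_ar //; auto.
Qed.

Definition trivial_rule j := has (fun p => (RL p == j) && (E p == H j)) (iota 0 T).

Lemma mark_trivialP s : base s -> (forall j, j < M -> ar s 8 j = 0) ->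
  forall j, j < M -> ar (run L mark_trivial s) 8 j = trivial_rule j.
Proof.
move=> bs z8; case: (bs) => [[_ Tv] _].
have := @run_for L vP vT (IfEq (Get 3 (V vP)) (Get 5 (Get 4 (V vP))) (Put 8 (Get 4 (V vP)) (N 1)))
  s (fun i s' => forall j, j < M ->
   ar s' 8 j = has (fun p => (RL p == j) && (E p == H j)) (iota 0 i)).
rewrite Tv; apply=> //.
move=> i s' iT xi sm h1 j jM; have [_ [e3 e4 e5 _ _]] := base_same sm isT bs.
rewrite iotaSr has_rcons add0n /= xi /idx /= e3 e4 e5 eqe0.
case: (j =P RL i) => [->|nj]; last first.
  by rewrite (eq_sym (RL i)) (introF eqP nj) /= -h1 //; case: ifP => //= _; rewrite (introF eqP nj).
by rewrite eqxx; case: ifP => _ /=; [rewrite eqxx | rewrite h1 ?RLM].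
Qed.

Lemma count_rulesP s : base s -> (forall y, relevant y -> ar s 9 y = 0) ->
  forall y, relevant y -> ar (run L count_rules s) 9 y =
    count (fun j => (H j == y) && (ar s 8 j == 0)) (iota 0 M).
Proof.
move=> bs z9; case: (bs) => [[Mv _] _].
have := @run_for L vJ vM (IfZ (Get 8 (V vJ)) (Put 9 (Get 5 (V vJ)) (Plus (Get 9 (Get 5 (V vJ))) (N 1))))
  s (fun i s' => forall y, relevant y ->
   ar s' 9 y = count (fun j => (H j == y) && (ar s 8 j == 0)) (iota 0 i)).
rewrite Mv; apply=> //.
move=> i s' iT xi sm h1 y ry; have [_ [_ _ e5 _ _]] := base_same sm isT bs.
have e8 j : ar s' 8 j = ar s 8 j by apply: sm.2.
rewrite iotaSr -cats1 count_cat /= add0n addn0 -h1 // xi /idx /= e8.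
case: ifP => [_|_] /=; last by rewrite andbF addn0.
by rewrite e5 eq_sym; case: eqP => [->|_] //=; rewrite addn0.
Qed.

Definition blocked i q y := (y == q) + count (fun p => (RL p == i) && (E p == y)) (iota 0 T).

Lemma blockP s : base s -> forall y,
  ar (run L block s) 9 y = ar s 9 y + blocked (va s vI) (va s vq) y.
Proof.
move=> bs; rewrite /block run_seq; set s1 := run L (Put 9 _ _) s.
have b1 : base s1 by apply: base_run bs.
have s19 y : ar s1 9 y = ar s 9 y + (y == va s vq).
  by rewrite /= /idx /=; case: eqP => [->|]; rewrite ?addn0.
have I1 : va s1 vI = va s vI by [].
move: s1 b1 s19 I1 => s1 b1 s19 I1 y.
case: (b1) => [[_ Tv] _].
have := @run_for L vP vT (IfEq (Get 4 (V vP)) (V vI)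
        (Put 9 (Get 3 (V vP)) (Plus (Get 9 (Get 3 (V vP))) (N 1))))
  s1 (fun i s' => forall y, ar s' 9 y = ar s1 9 y +
   count (fun p => (RL p == va s vI) && (E p == y)) (iota 0 i)).
rewrite Tv /blocked addnA -s19; apply=> // [z|]; first by rewrite addn0.
move=> {y}i s' iT xi sm h1 y; have [_ [e3 e4 _ _ _]] := base_same sm isT b1.
have I' : va s' 2 = va s 2 by rewrite -[RHS]I1; apply: sm.1.
rewrite iotaSr -cats1 count_cat /= add0n addn0 addnA -h1 // xi I' /idx /= e4 eqe0 /vI.
case: ifP => [_|_] /=; last by rewrite addn0.
by rewrite e3 eq_sym; case: eqP => [->|_] //=; rewrite addn0.
Qed.

Definition init := Seq reset (Seq mark_trivial (Seq count_rules block)).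

Lemma initP s : base s -> let s' := run L init s in
  [/\ forall p, p < T -> ar s' 10 p = 0, forall p, p < T -> ar s' 12 (E p) = 0,
    forall j, j < M -> ar s' 8 j = trivial_rule j &
    forall y, relevant y ->
      ar s' 9 y = count (fun j => (H j == y) && (ar s' 8 j == 0)) (iota 0 M)
        + blocked (va s vI) (va s vq) y].
Proof.
move=> bs; set s1 := run L reset s.
have b1 : base s1 by apply: base_run bs.
have [f1 d1 h1 c1] := resetP bs; rewrite -/s1 in f1 d1 h1 c1.
set s2 := run L mark_trivial s1.
have b2 : base s2 by apply: base_run b1.
have h2 := mark_trivialP b1 h1; rewrite -/s2 in h2.
have c2 y : relevant y -> ar s2 9 y = 0 by move=> ry; rewrite run_ar ?c1.
set s3 := run L count_rules s2.
have b3 : base s3 by apply: base_run b2.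
have c3 := count_rulesP b2 c2; rewrite -/s3 in c3.
rewrite (_ : run L init s = run L block s3) //; split=> [p pT|p pT|j jM|y ry].
- by rewrite run_ar // /s3 run_ar // /s2 run_ar // f1.
- by rewrite run_ar // /s3 run_ar // /s2 run_ar // d1.
- by rewrite run_ar // /s3 run_ar // h2.
rewrite blockP // c3 //; congr (_ + _); last by rewrite /s3 !run_va // /s2 !run_va // /s1 !run_va.
by apply: eq_count => j; rewrite run_ar // /s3 run_ar.
Qed.

Hypothesis NXE : forall p, p < T -> NX p = lo E (E p) p.
Hypothesis LAE : forall y, LA y = lo E y T.

Definition qs s := [seq ar s 11 k | k <- iota 0 (va s vtail)].

Definition queue_ok s :=
  [/\ uniq (qs s), forall z, z \in qs s -> z < T
    & forall z, z < T -> (ar s 10 z == 0) = (z \notin qs s)].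

Lemma pushP e s (v := eval L s e) : queue_ok s -> v <= T ->
  let s' := run L (push e) s in queue_ok s' /\ qs s' = addq v (qs s).
Proof.
move=> qo vT; rewrite /push /= -/v /addq; case: eqP => [v0|v0] //=.
have [uq lq fq] := qo; have zT : v - 1 < T by lia.
rewrite /idx /= fq // -subn1; case: ifP => [zq|zq]; last by rewrite (negbFE zq).
rewrite (negbTE zq); set s' := setv _ vtail _.
have qE : qs s' = rcons (qs s) (v - 1).
  rewrite /qs /s' /= addn1 iotaSr map_rcons add0n eqxx /=; congr rcons.
  by apply: eq_map_iota => i hi; rewrite ifF //; lia.
split=> //; split.
- by rewrite qE rcons_uniq zq.
- by move=> z; rewrite qE mem_rcons inE => /orP[/eqP->//|/lq].
- move=> z zT'; rewrite qE mem_rcons inE negb_or /s' /= /idx /=.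
  by case: (z =P v - 1) => // _; rewrite fq.
Qed.

Lemma startP s : base s -> (forall p, p < T -> ar s 10 p = 0) ->
  let s' := run L start s in
  [/\ queue_ok s', forall p, p \in qs s' -> ar s 9 (E p) = 0
    & forall p, p < T -> ar s 9 (E p) = 0 -> p \in qs s'].
Proof.
move=> bs z10; rewrite /start run_seq; set s1 := run L (Assign _ _) s.
have b1 : base s1 by apply: base_run bs.
have q1 : queue_ok s1 /\ qs s1 = [::].
  by split=> //; split=> // z zT; rewrite /s1 /= z10.
have c1 y : ar s1 9 y = ar s 9 y by [].
move: s1 b1 q1 c1 => s1 b1 q1 c1; case: (b1) => [[_ Tv] _].
have := @run_for L vP vT (IfZ (Get 9 (Get 3 (V vP))) (push (Plus (V vP) (N 1)))) s1 (fun i s' =>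
  [/\ queue_ok s', forall p, p \in qs s' -> ar s 9 (E p) = 0
    & forall p, p < i -> ar s 9 (E p) = 0 -> p \in qs s']).
rewrite Tv; apply=> //; first by case: q1 => q1 ->.
move=> i s' iT xi sm [qo qz qi]; have [_ [e3 _ _ _ _]] := base_same sm isT b1.
rewrite run_IfZ; have c' y : ar s' 9 y = ar s 9 y by rewrite -c1; apply: sm.2.
have ev : eval L s' (Plus (V vP) (N 1)) = i.+1 by rewrite /= xi addn1.
have := @pushP (Plus (V vP) (N 1)) s' qo; rewrite ev => /(_ iT) [qo' qE].
have -> : eval L s' (Get 9 (Get 3 (V vP))) = ar s 9 (E i) by rewrite /= xi /idx /= e3 c'.
case: ifP => [/eqP c0|c0].
  split=> // p; rewrite qE mem_addq /=.
    by case/orP=> [/qz//|/eqP->].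
  rewrite ltnS leq_eqVlt => /orP[/eqP->|pi c]; first by rewrite eqxx orbT.
  by rewrite qi.
split=> // p; rewrite ltnS leq_eqVlt => /orP[/eqP->|]; last exact: qi.
by move/eqP; rewrite c0.
Qed.

(** * Invariant of forward chaining *)

Section Sound.
Variables (B : nat -> nat) (W : nat -> Prop).
Hypothesis Wclosed : forall y, relevant y -> B y = 0 ->
  (forall j, j < M -> H j = y -> trivial_rule j \/ exists p, [/\ p < T, RL p = j & W (E p)]) -> W y.

(** [take k l] is the visited part of the queue. The third clause is soundness, for any [W] closed
    under chaining. The last two give completeness: once the whole queue is visited, it contains
    every occurrence of each element with count 0. *)
Definition bfs_inv k (hit cnt : nat -> nat) (l : seq nat) :=
  [/\ forall j, j < M -> hit j = trivial_rule j || has (fun p => RL p == j) (take k l) :> nat,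
      forall y, relevant y ->
        cnt y = count (fun j => (H j == y) && (hit j == 0)) (iota 0 M) + B y,
      forall p, p \in l -> [/\ p < T, cnt (E p) = 0 & W (E p)],
      forall y p, relevant y -> cnt y = 0 -> LA y = p.+1 -> p \in l
    & forall p p', p \in take k l -> NX p = p'.+1 -> p' \in l].

(** A zero count leaves no unhit rule for [y], and each rule hit so far is trivial or was hit by an
    element of [W]. *)
Lemma inv_sound k hit cnt (l : seq nat) y :
  (forall j, j < M -> hit j = trivial_rule j || has (fun p => RL p == j) (take k l) :> nat) ->
  (forall p, p \in l -> [/\ p < T, cnt (E p) = 0 & W (E p)]) ->
  relevant y -> count (fun j => (H j == y) && (hit j == 0)) (iota 0 M) + B y = 0 -> W y.
Proof.
move=> hh hl ry c0; apply: Wclosed => // [|j jM Hj]; first by lia.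
have := hh j jM; case: (trivial_rule j) => /= [_|]; first by left.
case: hasP => [[p /mem_take pl /eqP pj] _|_ h0].
  by right; exists p; have [pT _ Wp] := hl p pl.
suff: 0 < count (fun j => (H j == y) && (hit j == 0)) (iota 0 M) by lia.
by rewrite -has_count; apply/hasP; exists j; rewrite ?mem_iota // Hj h0 !eqxx.
Qed.

Lemma inv_skip k hit cnt l p : k < size l -> p = nth 0 l k -> hit (RL p) != 0 ->
  bfs_inv k hit cnt l -> bfs_inv k.+1 hit cnt (addq (NX p) l).
Proof.
move=> kl pE hp [hh hc hl hi hn]; have pl : p \in l by rewrite pE mem_nth.
have [pT c0 Wp] := hl p pl.
have tE : take k.+1 (addq (NX p) l) = rcons (take k l) p.
  by rewrite take_addq // (take_nth 0) // -pE.
split=> //.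
- move=> j jM; rewrite tE has_rcons orbCA hh //; case: eqP => // <-.
  by have := hh (RL p) (RLM pT); move: hp; case: (_ || _) => //= /eqP.
- move=> z; rewrite mem_addq => /orP[/hl//|/andP[nx /eqP zE]].
  have [zp Ez] : z < p /\ E z = E p by apply: lo_some; rewrite -NXE // zE; lia.
  by rewrite Ez; split=> //; lia.
- by move=> y z ry cy /(hi _ _ ry cy); rewrite mem_addq => ->.
- move=> z z'; rewrite tE mem_rcons inE => /orP[/eqP->|zl] nz; rewrite mem_addq.
    by rewrite nz /= eqxx orbT.
  by rewrite (hn _ _ zl nz).
Qed.

Lemma inv_fire k hit cnt l p hit' cnt' (j := RL p) (y0 := H j) :
  k < size l -> p = nth 0 l k -> hit j = 0 ->
  (forall i, hit' i = if i == j then 1 else hit i) ->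
  (forall y, cnt' y = cnt y - (y == y0)) ->
  bfs_inv k hit cnt l ->
  bfs_inv k.+1 hit' cnt' (addq (NX p) (addq (if cnt' y0 == 0 then LA y0 else 0) l)).
Proof.
move=> kl pE h0 hE cE [hh hc hl hi hn]; have pl : p \in l by rewrite pE mem_nth.
have [pT c0 Wp] := hl p pl; have jM : j < M := RLM pT.
set v := if _ then _ else _; set l1 := addq v l.
have tE : take k.+1 (addq (NX p) l1) = rcons (take k l) p.
  by rewrite !take_addq ?(leq_trans kl (size_addq _ _)) // (take_nth 0) // -pE.
have sub z : z \in l -> z \in l1 by rewrite mem_addq => ->.
have sub1 z : z \in l1 -> z \in addq (NX p) l1 by rewrite mem_addq => ->.
have hh' i : i < M -> hit' i = trivial_rule i || has (fun p => RL p == i) (take k.+1 l) :> nat.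
  move=> iM; rewrite hE (take_nth 0) // -pE has_rcons orbCA eq_sym -/j.
  by case: eqP => // _; rewrite /= hh.
have hc' y : relevant y ->
    cnt' y = count (fun i => (H i == y) && (hit' i == 0)) (iota 0 M) + B y.
  move=> ry; rewrite cE hc //; case: (y =P y0) => [->|ny].
    (* Rule [j] is the only one to leave the count of its head. *)
    rewrite (@count_remove _ (fun i => (H i == y0) && (hit' i == 0)) j) ?iota_uniq ?mem_iota //.
    + by rewrite addSn subSS subn0.
    + by rewrite h0 !eqxx.
    + by rewrite hE eqxx andbF.
    + by move=> i /negbTE ij; rewrite hE ij.
  rewrite subn0; congr (_ + _); apply: eq_count => i; rewrite hE.
  by case: (i =P j) => // ->; rewrite -/y0 eq_sym (introF eqP ny).
have ry0 : relevant y0 by apply: relevantH.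
have hl1 z : z \in l1 -> [/\ z < T, cnt' (E z) = 0 & W (E z)].
  rewrite mem_addq => /orP[/hl[zT cz Wz]|]; first by rewrite cE cz.
  rewrite /v; case: (cnt' y0 =P 0) => // c'0 /andP[n0 /eqP zE].
  have [zT Ez] : z < T /\ E z = y0 by apply: lo_some; rewrite -LAE zE; lia.
  (* The head may join because of the rule just hit, so soundness is applied with [k.+1] visited
     occurrences. *)
  rewrite Ez; split=> //; apply: (@inv_sound k.+1 hit' cnt' l) => //.
    by move=> x /hl[xT cx Wx]; rewrite cE cx.
  by rewrite -hc'.
split=> //.
- by move=> i iM; rewrite hh' // tE (take_nth 0) // -pE.
- move=> z; rewrite mem_addq => /orP[/hl1//|/andP[nx /eqP zE]].
  have [zp Ez] : z < p /\ E z = E p by apply: lo_some; rewrite -NXE // zE; lia.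
  by rewrite Ez; split=> //; [lia | rewrite cE c0].
- move=> y z ry cy lz; apply: sub1; case: (y =P y0) => [yE|ny].
    by rewrite mem_addq /v -yE cy lz /= eqxx orbT.
  by apply/sub/(hi y) => //; rewrite -cy cE (introF eqP ny) subn0.
- move=> z z'; rewrite tE mem_rcons inE => /orP[/eqP->|zl] nz.
    by rewrite mem_addq nz /= eqxx orbT.
  exact/sub1/sub/(hn _ _ zl nz).
Qed.

Lemma fireP s (j := va s vJ) : base s -> queue_ok s ->
  let s' := run L fire s in
  [/\ forall i, ar s' 8 i = if i == j then 1 else ar s 8 i,
      forall y, ar s' 9 y = ar s 9 y - (y == H j), queue_ok s' &
      qs s' = addq (if ar s 9 (H j) - 1 == 0 then LA (H j) else 0) (qs s)].
Proof.
move=> bs qo; have [_ [_ _ e5 _ e7]] := bs.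
set s1 := run L (Put 8 (V vJ) (N 1)) s.
set s2 := run L (Put 9 (Get 5 (V vJ)) (Minus (Get 9 (Get 5 (V vJ))) (N 1))) s1.
have h2 i : ar s2 8 i = if i == j then 1 else ar s 8 i by [].
have c2 y : ar s2 9 y = ar s 9 y - (y == H j).
  rewrite /s2 /= /idx /= -/vJ -/j e5; case: eqP => [->//|_]; by rewrite subn0.
have q2 : queue_ok s2 by [].
have qE : qs s2 = qs s by [].
have ev : eval L s2 (Get 7 (Get 5 (V vJ))) = LA (H j) by rewrite /= /idx /= -/vJ -/j e5 e7.
have ec : eval L s2 (Get 9 (Get 5 (V vJ))) = ar s 9 (H j) - 1.
  by rewrite [LHS](c2 (ar s2 5 j)) /= e5 eqxx.
rewrite (_ : run L fire s = run L (IfZ (Get 9 (Get 5 (V vJ))) (push (Get 7 (Get 5 (V vJ))))) s2) //.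
rewrite run_IfZ ec; case: ifP => c0; last by split.
have := @pushP (Get 7 (Get 5 (V vJ))) s2 q2; rewrite ev LAE => /(_ (lo_le _ _ _)) [q3 q3E].
by split=> // *; rewrite run_ar.
Qed.

Lemma visitP k s : base s -> va s vK = k -> k < size (qs s) ->
  queue_ok s /\ bfs_inv k (ar s 8) (ar s 9) (qs s) ->
  let s' := run L visit s in queue_ok s' /\ bfs_inv k.+1 (ar s' 8) (ar s' 9) (qs s').
Proof.
move=> bs kE kl [qo Ik].
set s1 := run L (Assign vP (Get 11 (V vK))) s; set s2 := run L (Assign vJ (Get 4 (V vP))) s1.
have [_ [_ e4 _ e6 _]] := bs.
have szq : size (qs s) = va s vtail by rewrite size_map size_iota.
set p := nth 0 (qs s) k; have pE : va s2 vP = p.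
  by rewrite /p /qs (nth_map 0) ?size_iota -?szq // nth_iota -?szq //= /idx /= kE.
have jE : va s2 vJ = RL p by rewrite -pE /= /idx /= e4.
have b2 : base s2 by apply: base_run => //; apply: base_run bs.
have q2 : queue_ok s2 by [].
have I2 : bfs_inv k (ar s2 8) (ar s2 9) (qs s2) by [].
have pl : p \in qs s2 by rewrite mem_nth.
have kl2 : k < size (qs s2) by [].
have p2 : p = nth 0 (qs s2) k by [].
have [hh _ hl _ _] := I2; have [pT cp _] := hl p pl.
rewrite (_ : run L visit s = run L (push (Get 6 (V vP)))
  (run L (IfZ (Get 8 (V vJ)) fire) s2)) // run_IfZ.
have -> : eval L s2 (Get 8 (V vJ)) = ar s2 8 (RL p) by rewrite -jE.
move: s1 s2 pE jE b2 q2 I2 pl kl2 p2 hh hl cp => _ s2 pE jE b2 q2 I2 pl kl2 p2 hh hl cp.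
have NXT : NX p <= T by rewrite NXE //; apply: leq_trans (lo_le _ _ _) (ltnW pT).
have last_push s3 : va s3 vP = p -> ar s3 6 p = NX p -> queue_ok s3 ->
    bfs_inv k.+1 (ar s3 8) (ar s3 9) (addq (NX p) (qs s3)) ->
    let s' := run L (push (Get 6 (V vP))) s3 in
    queue_ok s' /\ bfs_inv k.+1 (ar s' 8) (ar s' 9) (qs s').
  move=> p3 n3 q3 I3; have ev : eval L s3 (Get 6 (V vP)) = NX p by rewrite /= /idx /= p3.
  have := @pushP (Get 6 (V vP)) s3 q3; rewrite ev => /(_ NXT) [q4 q4E].
  split=> //; case: I3 => h3 c3 l3 i3 n4; rewrite q4E; split=> //.
  - by move=> i iM; rewrite run_ar // h3.
  - move=> y ry; rewrite run_ar // c3 //; congr (_ + _).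
    by apply: eq_count => i; rewrite run_ar.
  - by move=> z /l3; rewrite run_ar.
  - by move=> y z ry; rewrite run_ar //; exact: i3.
have [_ [_ _ _ e62 _]] := b2.
case: ifP => [/eqP h0|/negbT h0]; last by apply: last_push => //; apply: inv_skip.
have [h3 c3 q3 q3E] := fireP b2 q2; set s3 := run L fire s2 in h3 c3 q3 q3E *.
apply: last_push => //; rewrite ?run_va ?run_ar //.
rewrite jE in h3 c3 q3E; rewrite {}q3E.
have -> : ar s2 9 (H (RL p)) - 1 = ar s3 9 (H (RL p)) by rewrite c3 eqxx.
exact: (inv_fire kl2 p2 h0 h3 c3 I2).
Qed.

Lemma bfsP s : base s -> queue_ok s -> bfs_inv 0 (ar s 8) (ar s 9) (qs s) ->
  let s' := run L bfs s in
  [/\ forall j, j < M -> ar s' 8 j =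
        trivial_rule j || has (fun p => (RL p == j) && (ar s' 9 (E p) == 0)) (iota 0 T) :> nat,
      forall y, relevant y -> ar s' 9 y =
        count (fun j => (H j == y) && (ar s' 8 j == 0)) (iota 0 M) + B y
    & forall p, p < T -> ar s' 9 (E p) = 0 -> W (E p)].
Proof.
move=> bs qo I0; case: (bs) => [[_ Tv] _].
have := @run_for L vK vT (IfN (Minus (V vtail) (V vK)) visit) s (fun i s' =>
  queue_ok s' /\ bfs_inv i (ar s' 8) (ar s' 9) (qs s')).
rewrite Tv; case=> // [i s' iT xi sm [qo' Ii]|].
  have b' := base_same sm isT bs.
  have szq : size (qs s') = va s' vtail by rewrite size_map size_iota.
  rewrite run_IfN; have -> : eval L s' (Minus (V vtail) (V vK)) = va s' vtail - i by rewrite /= xi.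
  case: ifP => [ti|ti]; last by apply: visitP => //; rewrite szq; lia.
  split=> //; case: Ii => hh hc hl hi hn.
  (* The queue is exhausted: the round is idle and all entries already count as visited. *)
  have eT k : i <= k -> take k (qs s') = qs s' by move=> ik; rewrite take_oversize // szq; lia.
  by rewrite eT // in hh hn; split=> //; rewrite eT.
set s' := run L _ s => -[[uq lq _] [hh hc hl hi hn]].
(* Entries are distinct and below [T], so [T] rounds empty the queue. *)
have szT : size (qs s') <= T.
  by rewrite -[T](size_iota 0); apply: uniq_leq_size => // z /lq; rewrite mem_iota.
rewrite take_oversize // in hh hn.
have full p : p < T -> ar s' 9 (E p) = 0 -> p \in qs s'.
  move=> pT c0; apply: (@lo_closed E (E p) T) => //.
    by move=> z; rewrite -LAE; apply: hi => //; apply: relevantE.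
  by move=> z z' zl ez; rewrite -ez -NXE; [exact: hn | have [] := hl z zl].
split=> //; last by move=> p pT /(full p pT) /hl[].
move=> j jM; rewrite hh //; congr (nat_of_bool (_ || _)).
apply/hasP/hasP => [[p pl pj]|[p]]; first by exists p; have [pT c0 _] := hl p pl; rewrite ?mem_iota // pj c0.
by rewrite mem_iota => /andP[_ pT] /andP[pj /eqP c0]; exists p; rewrite ?full.
Qed.

End Sound.

Lemma verdictP s (i := va s vI) (q := va s vq) : base s ->
  va (run L verdict s) vok = (ar s 8 i == 0) &&
    ~~ has (fun j => [&& j < i, H j == q & ar s 8 j == 0]) (iota 0 M) :> nat.
Proof.
move=> bs; rewrite /verdict run_seq; set s1 := run L (Assign _ _) s.
have b1 : base s1 by apply: base_run bs.
have e8 j : ar s1 8 j = ar s 8 j by [].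
have ok1 : va s1 vok = (ar s 8 i == 0) by rewrite /s1 /= /idx /= -/i; lia.
have [i1 q1] : va s1 vI = i /\ va s1 vq = q by [].
move: s1 b1 e8 ok1 i1 q1 => s1 b1 e8 ok1 i1 q1; case: (b1) => [[Mv _] _].
have := @run_for L vJ vM (IfN (Minus (V vI) (V vJ)) (IfEq (Get 5 (V vJ)) (V vq)
   (IfZ (Get 8 (V vJ)) (Assign vok (N 0))))) s1 (fun k s' =>
   va s' vok = (ar s 8 i == 0) &&
    ~~ has (fun j => [&& j < i, H j == q & ar s 8 j == 0]) (iota 0 k) :> nat).
rewrite Mv; apply=> //; first by rewrite andbT.
move=> k s' kM xi sm h; have [_ [_ _ e5 _ _]] := base_same sm isT b1.
have [iv qv] : va s' vI = i /\ va s' vq = q by rewrite -i1 -q1; split; apply: sm.1.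
have e8' j : ar s' 8 j = ar s 8 j by rewrite -e8; apply: sm.2.
rewrite iotaSr has_rcons add0n negb_or andbCA run_IfN.
have -> : eval L s' (Minus (V vI) (V vJ)) = i - k by rewrite /= xi iv.
case: eqP => [ik|ik].
  by rewrite h; have -> : k < i = false by lia.
have -> : k < i by lia.
have ev5 : eval L s' (Get 5 (V vJ)) = H k by rewrite /= /idx /= xi e5.
have evq : eval L s' (V vq) = q by [].
have ev8 : eval L s' (Get 8 (V vJ)) = ar s 8 k by rewrite /= /idx /= xi e8'.
rewrite run_IfEq ev5 evq.
case: (H k == q) => //; rewrite run_IfZ ev8.
by case: (ar s 8 k == 0).
Qed.

Lemma tally_unhitP s (q := va s vq) : base s -> forall y,
  ar (run L tally_unhit s) 12 y = ar s 12 y +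
    count (fun p => [&& H (RL p) == q, ar s 8 (RL p) == 0 & E p == y]) (iota 0 T).
Proof.
move=> bs; case: (bs) => [[_ Tv] _].
have := @run_for L vP vT (IfEq (Get 5 (Get 4 (V vP))) (V vq) (IfZ (Get 8 (Get 4 (V vP)))
    (Put 12 (Get 3 (V vP)) (Plus (Get 12 (Get 3 (V vP))) (N 1))))) s (fun i s' => forall y,
  ar s' 12 y = ar s 12 y +
    count (fun p => [&& H (RL p) == q, ar s 8 (RL p) == 0 & E p == y]) (iota 0 i)).
rewrite Tv; apply=> // [y|i s' iT xi sm h y]; first by rewrite addn0.
have [_ [e3 e4 e5 _ _]] := base_same sm isT bs.
have e8 j : ar s' 8 j = ar s 8 j by apply: sm.2.
have qv : va s' vq = q by apply: sm.1.
rewrite iotaSr -cats1 count_cat add0n addnA -h run_IfEq run_IfZ.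
have -> : eval L s' (Get 8 (Get 4 (V vP))) = ar s 8 (RL i) by rewrite /= /idx /= xi e4 e8.
have -> : eval L s' (Get 5 (Get 4 (V vP))) = H (RL i) by rewrite /= /idx /= xi e4 e5.
have -> : eval L s' (V vq) = q by [].
rewrite [count _ [:: _]]/= addn0.
case: (H (RL i) == q); last by rewrite addn0.
case: (ar s 8 (RL i) == 0); last by rewrite addn0.
rewrite /= /idx /= xi.
by rewrite e3 eq_sym; case: eqP => [->|_] //=; rewrite addn0.
Qed.

Lemma checkP s (b : bool) (i := va s vI) (q := va s vq) : base s -> va s vok = b ->
  va (run L check s) vok = b && all (fun p => (RL p == i) && (ar s 9 (E p) == 1) ==>
     (ar s 12 (E p) + 1 == ar s 9 q)) (iota 0 T) :> nat.
Proof.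
move=> bs bE; case: (bs) => [[_ Tv] _].
have := @run_for L vP vT (IfEq (Get 4 (V vP)) (V vI) (IfEq (Get 9 (Get 3 (V vP))) (N 1)
    (IfN (eqe (Plus (Get 12 (Get 3 (V vP))) (N 1)) (Get 9 (V vq))) (Assign vok (N 0)))))
   s (fun k s' => va s' vok = b && all (fun p => (RL p == i) && (ar s 9 (E p) == 1) ==>
     (ar s 12 (E p) + 1 == ar s 9 q)) (iota 0 k) :> nat).
rewrite Tv; apply=> //; first by rewrite andbT.
move=> k s' kT xi sm h; have [_ [e3 e4 _ _ _]] := base_same sm isT bs.
have e9 y : ar s' 9 y = ar s 9 y by apply: sm.2.
have e12 y : ar s' 12 y = ar s 12 y by apply: sm.2.
have [qv iv] : va s' vq = q /\ va s' vI = i by split; apply: sm.1.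
rewrite iotaSr all_rcons add0n andbCA !run_IfEq.
have -> : eval L s' (Get 4 (V vP)) = RL k by rewrite /= /idx /= xi e4.
have -> : eval L s' (V vI) = i by [].
have -> : eval L s' (Get 9 (Get 3 (V vP))) = ar s 9 (E k) by rewrite /= /idx /= xi e3 e9.
have -> : eval L s' (N 1) = 1 by [].
case: (RL k == i) => //; case: (ar s 9 (E k) == 1) => //.
rewrite run_IfN.
have -> : eval L s' (eqe (Plus (Get 12 (Get 3 (V vP))) (N 1)) (Get 9 (V vq))) == 0
   = (ar s 12 (E k) + 1 == ar s 9 q).
  by rewrite /= eqe0 /idx /= xi e3 e12 -/vq qv e9.
by case: (_ == _).
Qed.

Definition tails_of s i :=
  [seq E p | p <- iota 0 T & (RL p == i) && (ar s 9 (E p) == 1)].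

Lemma emitP s (i := va s vI) (q := va s vq) : base s -> 2 <= va s vO ->
  let s' := run L emit s in
  [/\ outs s' = outs s ++ [:: q, size (tails_of s i) & tails_of s i],
    2 <= va s' vO & va s' vC = (va s vC).+1].
Proof.
move=> bs O2; set O0 := va s vO.
set s1 := run L (Put 1 (V vO) (V vq)) s.
set s2 := run L (Assign vO (Plus (V vO) (N 2))) (run L (Assign vszpos (Plus (V vO) (N 1))) s1).
set s3 := run L emit_tails s2.
rewrite (_ : run L emit s =
  run L (Inc vC) (run L (Put 1 (V vszpos) (Minus (Minus (V vO) (V vszpos)) (N 1))) s3)) //.
have b2 : base s2 by apply: base_run bs.
have [O2E i2 c2] : [/\ va s2 vO = O0.+2, va s2 vI = i & va s2 vC = va s vC].
  by split=> //; rewrite /s2 /= addn2.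
have z2 : va s2 vszpos = O0.+1 by rewrite /s2 /= addn1.
have a2 k : ar s2 1 k = if k == O0 then q else ar s 1 k by [].
have c9 y : ar s2 9 y = ar s 9 y by [].
move: (s2) b2 O2E i2 c2 z2 a2 c9 @s3 => {s1}{}s2 b2 O2E i2 c2 z2 a2 c9 s3.
pose A k := [seq E p | p <- iota 0 k & (RL p == i) && (ar s 9 (E p) == 1)].
have [O3 a3 t3] : [/\ va s3 vO = O0.+2 + size (A T),
    forall k, k < O0.+2 -> ar s3 1 k = ar s2 1 k &
    [seq ar s3 1 k | k <- iota O0.+2 (size (A T))] = A T].
  case: (b2) => [[_ Tv] _]; have := @run_for L vP vT
    (IfEq (Get 4 (V vP)) (V vI) (IfEq (Get 9 (Get 3 (V vP))) (N 1)
    (Seq (Put 1 (V vO) (Get 3 (V vP))) (Inc vO)))) s2 (fun j s' =>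
    [/\ va s' vO = O0.+2 + size (A j),
    forall k, k < O0.+2 -> ar s' 1 k = ar s2 1 k &
    [seq ar s' 1 k | k <- iota O0.+2 (size (A j))] = A j]).
  rewrite Tv; apply=> //; first by rewrite addn0.
  move=> j s' jT xi sm [OE aE tE]; have [_ [e3 e4 _ _ _]] := base_same sm isT b2.
  have e9 y : ar s' 9 y = ar s 9 y by rewrite -c9; apply: sm.2.
  have iv : va s' vI = i by rewrite -i2; apply: sm.1.
  have AE : A j.+1 = if (RL j == i) && (ar s 9 (E j) == 1) then rcons (A j) (E j) else A j.
    by rewrite /A iotaSr filter_rcons add0n; case: ifP => // _; rewrite map_rcons.
  rewrite AE !run_IfEq.
  have -> : eval L s' (Get 4 (V vP)) = RL j by rewrite /= /idx /= xi e4.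
  have -> : eval L s' (V vI) = i by [].
  have -> : eval L s' (Get 9 (Get 3 (V vP))) = ar s 9 (E j) by rewrite /= /idx /= xi e3 e9.
  have -> : eval L s' (N 1) = 1 by [].
  case: (RL j == i) => //; case: (ar s 9 (E j) == 1) => //.
  rewrite size_rcons iotaSr map_rcons /= /idx /= xi e3 -/vO OE; split.
  - by rewrite addn1 addnS.
  - by move=> k kO; rewrite /= ifF ?aE //; lia.
  - rewrite eqxx; congr rcons.
    rewrite -[RHS]tE; apply: eq_map_iota => k hk; rewrite /= ifF //; lia.
have z3 : va s3 vszpos = O0.+1 by rewrite run_va.
have c3 : va s3 vC = va s vC by rewrite run_va.
split.
- rewrite /outs /= -/vO O3 z3 -/O0.
  have -> : O0.+2 + size (A T) - 2 = (O0 - 2) + (size (A T)).+2 by rewrite /O0; lia.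
  have -> : O0.+2 + size (A T) - O0.+1 - 1 = size (A T) by lia.
  rewrite iotaD map_cat /=; have -> : 2 + (O0 - 2) = O0 by rewrite /O0; lia.
  rewrite /idx /= eqxx; congr (_ ++ [:: _, _ & _]).
  + apply: eq_map_iota => k hk; rewrite ifF ?a3 ?a2 ?ifF //; rewrite /O0; lia.
  + by rewrite ifF ?a3 ?a2 ?eqxx //; lia.
  + rewrite /tails_of -/(A T) -[RHS]t3; apply: eq_map_iota => k hk; rewrite ifF //; lia.
- by rewrite /= -/vO O3; lia.
- by rewrite /= -/vC c3 addn1.
Qed.

End Phases.

Definition propagate := Seq init (Seq start bfs).

Definition rule_body :=
  Seq (Assign vq (Get 5 (V vI)))
  (Seq propagate (Seq verdict (Seq tally_unhit (Seq check (IfN (V vok) emit))))).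

(** * From occurrence counts to rules and closures *)

Section Rules.
Variables (n : nat) (rs : seq (seq 'I_n * 'I_n)) (x0 : seq 'I_n * 'I_n).
Hypothesis wf : wf_rules rs.
Let R := set_of_rules rs.
Definition nat_rules (l : seq (seq 'I_n * 'I_n)) :=
  [seq (map val x.1, val x.2) | x <- l].
Let G := nat_rules rs.
Let M := size rs.
Let body j := (nth ([::], 0) G j).1.
Variables (L T : nat) (E RL H NX LA : nat -> nat).
Hypotheses (ML : M <= L) (TL : T <= L).
Hypothesis PE : [seq (RL p, E p) | p <- iota 0 T] = pairs G M.
Hypothesis HE : forall j, j < M -> H j = (nth ([::], 0) G j).2.
Hypothesis NXE : forall p, p < T -> NX p = lo E (E p) p.
Hypothesis LAE : forall y, LA y = lo E y T.
Local Notation base := (base M T E RL H NX LA).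
Local Notation relevant := (relevant M T E H).
Local Notation trivial_rule := (trivial_rule T E RL H).
Local Notation rl j := (nth x0 rs j).

Lemma nthG j : j < M -> nth ([::], 0) G j = (map val (rl j).1, val (rl j).2).
Proof. by move=> jM; rewrite (nth_map x0). Qed.

Lemma bodyE j : j < M -> body j = map val (rl j).1.
Proof. by move=> jM; rewrite /body nthG. Qed.

Lemma headE j : j < M -> H j = val (rl j).2.
Proof. by move=> jM; rewrite HE // nthG. Qed.

Lemma uniq_body j : j < M -> uniq (body j).
Proof.
move=> jM; rewrite bodyE // (map_inj_uniq val_inj).
by case/andP: wf => /allP h _; apply: h; apply: mem_nth.
Qed.

Lemma pairs_filter m i (g : pred nat) :
  [seq x.2 | x <- pairs G m & (x.1 == i) && g x.2] = if i < m then filter g (body i) else [::].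
Proof.
have aux k l : [seq x.2 | x <- [seq (k, e) | e <- l] & (x.1 == i) && g x.2]
    = if i == k then filter g l else [::] :> seq nat.
  elim: l => [|e l IHl] /=; first by case: ifP.
  by rewrite (eq_sym k); case: eqP IHl => //= _; case: ifP => //= _ ->.
elim: m => // m IH; rewrite /pairs iotaSr map_rcons flatten_rcons filter_cat map_cat -/(pairs G m) IH.
by rewrite add0n aux ltnS; case: (ltngtP i m) => [im|im|->] //=; rewrite cats0.
Qed.

(** Bodies have no duplicates, so counting occurrences of [y] counts the rules containing it. *)
Lemma pairs_count m (a : pred nat) y : m <= M ->
  count (fun x => a x.1 && (x.2 == y)) (pairs G m)
  = count (fun j => a j && (y \in body j)) (iota 0 m).
Proof.
elim: m => // m IH mM; rewrite /pairs iotaSr map_rcons flatten_rcons count_cat -/(pairs G m).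
rewrite IH ?(ltnW mM) // -cats1 count_cat /= addn0 add0n count_map /=; congr (_ + _).
rewrite (eq_count (a2 := fun e => a m && (e == y))) //.
case: (a m) => /=; last by rewrite count_pred0.
by rewrite -/(body m) -count_uniq_mem ?uniq_body //.
Qed.

Lemma filterT i (g : pred nat) : i < M ->
  [seq E p | p <- iota 0 T & (RL p == i) && g (E p)] = filter g (body i).
Proof.
move=> iM; have := pairs_filter M i g; rewrite iM -PE => <-.
by rewrite filter_map -map_comp.
Qed.

Lemma hasT i (g : pred nat) : i < M ->
  has (fun p => (RL p == i) && g (E p)) (iota 0 T) = has g (body i).
Proof. by move=> iM; rewrite !has_filter -filterT // -!size_eq0 size_map. Qed.

Lemma countT i (g : pred nat) : i < M ->
  count (fun p => (RL p == i) && g (E p)) (iota 0 T) = count g (body i).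
Proof. by move=> iM; rewrite -!size_filter -filterT // size_map. Qed.

Lemma allT i (g h : pred nat) : i < M ->
  all (fun p => (RL p == i) && g (E p) ==> h (E p)) (iota 0 T)
  = all (fun e => g e ==> h e) (body i).
Proof.
move=> iM; rewrite -[LHS]negbK -[RHS]negbK -!has_predC; congr negb.
rewrite -(hasT (predC (fun e => g e ==> h e))) //; apply: eq_has => p /=.
by case: (RL p == i).
Qed.

Lemma count_mem_T (a : pred nat) y :
  count (fun p => a (RL p) && (E p == y)) (iota 0 T)
  = count (fun j => a j && (y \in body j)) (iota 0 M).
Proof. by rewrite -pairs_count // -PE count_map. Qed.

Lemma memT p : p < T -> RL p < M /\ E p \in body (RL p).
Proof.
move=> pT; have : 0 < count (fun p' => (RL p' == RL p) && (E p' == E p)) (iota 0 T).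
  by rewrite -has_count; apply/hasP; exists p; rewrite ?mem_iota // !eqxx.
rewrite (count_mem_T (fun j => j == RL p)) -has_count => /hasP[j].
by rewrite mem_iota => /andP[_ jM] /andP[/eqP <-].
Qed.

Lemma trivialE j : j < M -> trivial_rule j = ((rl j).2 \in (rl j).1).
Proof.
move=> jM; rewrite -[LHS]/(has (fun p => (RL p == j) && (E p == H j)) (iota 0 T)) (hasT (fun e => e == H j)) // bodyE // headE //.
by rewrite has_pred1 (mem_map val_inj).
Qed.

Lemma blockedE i q y : i < M -> blocked T E RL i q y = (y == q) + (y \in body i).
Proof.
by move=> iM; rewrite /blocked (countT (fun e => e == y)) // -count_uniq_mem ?uniq_body.
Qed.

Lemma relevant_ord y : relevant y -> exists y' : 'I_n, y = val y'.
Proof.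
case/orP=> /hasP[k]; rewrite mem_iota => /andP[_ kT] /eqP <-.
  have [jM] := memT kT; rewrite bodyE // => /mapP[y' _ ->]; by exists y'.
by rewrite headE //; exists (rl k).2.
Qed.

Lemma in_rules j : j < M -> rule_of (rl j) \in R.
Proof. by move=> jM; rewrite inE map_f // mem_nth. Qed.

Lemma rulesP r : r \in R -> exists2 j, j < M & r = rule_of (rl j).
Proof.
rewrite inE => /mapP[x xrs ->]; exists (index x rs); rewrite ?index_mem //.
by rewrite nth_index.
Qed.

Section OneRule.
Variable i : nat.
Hypothesis iM : i < M.
Let x := rl i.
Let q := val x.2.
Let W := closure_of R x.

Definition in_closure y := exists2 y' : 'I_n, y = val y' & y' \in W.

Lemma in_closureE (y : 'I_n) : in_closure (val y) <-> y \in W.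
Proof. by split=> [[y' /val_inj <-]|yW] //; exists y. Qed.

Lemma blocked0 (y : 'I_n) :
  (blocked T E RL i q (val y) == 0) = (y \notin x.2 |: [set a in x.1]).
Proof.
rewrite blockedE // bodyE // addn_eq0 !eqb0 !inE negb_or (mem_map val_inj).
by rewrite /q (inj_eq val_inj).
Qed.

(** This instantiates the closure hypothesis on [W] under which forward chaining was shown sound. *)
Lemma in_closure_closed y : relevant y -> blocked T E RL i q y = 0 ->
  (forall j, j < M -> H j = y ->
     trivial_rule j \/ exists p, [/\ p < T, RL p = j & in_closure (E p)]) -> in_closure y.
Proof.
move=> /relevant_ord[{}y ->] /eqP; rewrite blocked0 => yB h; exists y => //.
apply: maxfeas_in => //; apply/freeP => r /rulesP[j jM ->] /= ey; rewrite /unhit /=.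
have ej : H j = val y by rewrite headE // ey.
have [|[p [pT pj [z ez zW]]]] := h j jM ej.
  by rewrite trivialE // => tj; rewrite inE tj.
have [_] := memT pT; rewrite pj bodyE // ez (mem_map val_inj) => zj.
rewrite negb_and; apply/orP; right; apply/pred0Pn; exists z => /=.
by rewrite inE zj zW.
Qed.

Section Spec.
Variables (hit cnt : nat -> nat).
Hypothesis hitE : forall j, j < M ->
  hit j = trivial_rule j || has (fun p => (RL p == j) && (cnt (E p) == 0)) (iota 0 T) :> nat.
Hypothesis cntE : forall y, relevant y ->
  cnt y = count (fun j => (H j == y) && (hit j == 0)) (iota 0 M) + blocked T E RL i q y.
Hypothesis sound : forall p, p < T -> cnt (E p) = 0 -> in_closure (E p).

Lemma relevant_body j e : j < M -> e \in body j -> relevant e.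
Proof.
move=> jM ej; have : has (fun p => (RL p == j) && (E p == e)) (iota 0 T).
  by rewrite (hasT (fun y => y == e)) // has_pred1.
case/hasP=> p; rewrite mem_iota => /andP[_ pT] /andP[_ /eqP <-]; exact: relevantE.
Qed.

(** The elements with count 0 form a set stable under [grow], hence contain the least fixed
    point. *)
Lemma complete (y : 'I_n) : y \in W -> relevant (val y) -> cnt (val y) = 0.
Proof.
pose W' := [set y : 'I_n | relevant (val y) ==> (cnt (val y) == 0)].
suff sW : W \subset W' by move=> /(subsetP sW); rewrite inE => /implyP h /h/eqP.
apply: maxfeas_ind => {}y yB /freeP fy; rewrite inE; apply/implyP => ry.
rewrite cntE // addn_eq0 blocked0 yB andbT -leqn0 leqNgt -has_count; apply/hasP => -[j].
rewrite mem_iota => /andP[_ jM] /andP[/eqP]; rewrite headE // => /val_inj jy.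
rewrite hitE // eqb0 negb_or trivialE // => /andP[tj].
have := fy _ (in_rules jM) jy; rewrite /unhit /= inE tj /= => /pred0Pn[z /=].
rewrite inE => /andP[zj zW']; rewrite (hasT (fun e => cnt e == 0)) // => /hasPn/(_ (val z)).
have zb : val z \in body j by rewrite bodyE // mem_map //; exact: val_inj.
by move=> /(_ zb); move: zW'; rewrite inE (relevant_body jM zb) /= => ->.
Qed.

Lemma hit0 j : j < M -> (hit j == 0) = unhit W (rule_of (rl j)).
Proof.
move=> jM; rewrite hitE // eqb0 negb_or trivialE // /unhit /= inE; congr (_ && _).
rewrite (hasT (fun e => cnt e == 0)) //; apply/hasPn/idP => [h|d z].
  apply/pred0P => z /=; rewrite inE; apply/negbTE/negP => /andP[zj zW].
  have zb : val z \in body j by rewrite bodyE // mem_map //; exact: val_inj.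
  by have /eqP := h _ zb; apply; apply: complete => //; apply: relevant_body zb.
rewrite bodyE // => /mapP[z' zj ->]; apply/negP => /eqP c0.
have zb : val z' \in body j by rewrite bodyE // mem_map //; exact: val_inj.
have : has (fun p => (RL p == j) && (E p == val z')) (iota 0 T).
  by rewrite (hasT (fun y => y == val z')) // has_pred1.
case/hasP=> p; rewrite mem_iota => /andP[_ pT] /andP[_ /eqP ep].
have : z' \in W by apply/in_closureE; rewrite -ep; apply: sound; rewrite ?ep.
by move: d => /disjointFr -> //; rewrite inE.
Qed.

Lemma count_free (y : 'I_n) :
  (count (fun j => (H j == val y) && (hit j == 0)) (iota 0 M) == 0) = free R W y.
Proof.
rewrite -leqn0 leqNgt -has_count; apply/hasPn/freeP => [h r /rulesP[j jM ->] /= jy|h j].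
  have := h j; rewrite mem_iota jM => /(_ isT); rewrite headE // jy eqxx /=.
  by rewrite hit0.
rewrite mem_iota => /andP[_ jM]; rewrite headE // hit0 //.
by apply/negP => /andP[/eqP/val_inj jy]; apply/negP/(h _ (in_rules jM) jy).
Qed.

Hypothesis xunhit : unhit W (rule_of x).

(** [block] contributes exactly 1: [s] is in the body, and differs from [q] because the rule is
    unhit and so does not contain its head. *)
Lemma body_cnt (s : 'I_n) : s \in x.1 -> (cnt (val s) == 1) = free R W s.
Proof.
move=> sx; have sb : val s \in body i by rewrite bodyE // mem_map //; exact: val_inj.
rewrite cntE ?(relevant_body iM sb) // blockedE // sb -count_free.
have -> : (val s == q) = false.
  apply/negP => /eqP/val_inj sq; case/andP: xunhit; rewrite /= inE -/x.
  by rewrite -sq sx.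
by rewrite add0n addn1 eqSS.
Qed.

Lemma head_cnt : cnt q = (count (fun j => (H j == q) && (hit j == 0)) (iota 0 M)).+1.
Proof.
rewrite cntE; last by rewrite /q /x -headE //; apply: relevantH.
rewrite blockedE // eqxx bodyE // mem_map; last exact: val_inj.
by case/andP: xunhit; rewrite /= inE -/x => /negbTE -> _; rewrite addn0 addn1.
Qed.

Lemma tails_filter : [seq e <- body i | cnt e == 1] = map val (emitted R x).1.
Proof.
rewrite bodyE // filter_map; congr map; apply: eq_in_filter => s sx /=.
exact: body_cnt.
Qed.

Lemma count_all (S : Type) (a b : pred S) (l : seq S) :
  (count (fun z => a z && b z) l == count a l) = all (fun z => a z ==> b z) l.
Proof.
elim: l => //= z l IH; rewrite -IH; have : count (fun z => a z && b z) l <= count a l.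
  by apply: sub_count => y /andP[].
case: (a z); case: (b z) => //= h.
by rewrite add0n add1n ltn_eqF.
Qed.

(** Inclusion of the tails in all unhit bodies is checked element by element, and for each element
    by equality of two counts, as in [count_all]. *)
Lemma check_yields :
  all (fun p => (RL p == i) && (cnt (E p) == 1) ==>
     (count (fun p' => [&& H (RL p') == q, hit (RL p') == 0 & E p' == E p]) (iota 0 T) + 1
      == cnt q)) (iota 0 T) = yields R (rule_of x).
Proof.
have -> : yields R (rule_of x) = [forall r' in R, (r'.2 == x.2) && unhit W r' ==>
     (tails R W [set a in x.1] \subset r'.1)].
  by rewrite /yields in_rules //= -/(closure_of R x) -/W; move: xunhit => ->.
rewrite (allT (fun e => cnt e == 1) (fun e =>
  count (fun p' => [&& H (RL p') == q, hit (RL p') == 0 & E p' == e]) (iota 0 T) + 1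
      == cnt q)) //.
rewrite head_cnt; transitivity (all (fun s : 'I_n => free R W s ==>
   all (fun j => (H j == q) && (hit j == 0) ==> (val s \in body j)) (iota 0 M)) x.1).
  rewrite bodyE // all_map; apply: eq_in_all => s sx /=; rewrite body_cnt //; congr (_ ==> _).
  rewrite addn1 eqSS -count_all; congr (_ == _).
  rewrite -(count_mem_T (fun j => (H j == q) && (hit j == 0))).
  by apply: eq_count => p; rewrite andbA.
apply/allP/forall_inP => [h r /rulesP[j jM ->]|h s sx].
  apply/implyP => /= /andP[/eqP jx uj]; apply/subsetP => s; rewrite !inE => /andP[sx fs].
  have /implyP/(_ fs)/allP/(_ j) := h s sx; rewrite mem_iota jM => /(_ isT).
  rewrite headE // hit0 // jx uj eqxx bodyE // mem_map //; exact: val_inj.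
apply/implyP => fs; apply/allP => j; rewrite mem_iota => /andP[_ jM].
apply/implyP; rewrite headE // hit0 // => /andP[/eqP/val_inj jx uj].
have /implyP := h _ (in_rules jM); rewrite /= jx eqxx uj => /(_ isT)/subsetP/(_ s).
by rewrite !inE sx fs bodyE // mem_map; [apply | exact: val_inj].
Qed.

Lemma first_emits :
  has (fun j => [&& j < i, H j == q & hit j == 0]) (iota 0 M) = has (same_unhit R x) (take i rs).
Proof.
apply/hasP/hasP => [[j]|[y]].
  rewrite mem_iota => /andP[_ jM] /and3P[ji]; rewrite headE // hit0 // => /eqP/val_inj jx uj.
  exists (rl j); last by rewrite /same_unhit jx eqxx.
  by rewrite -(nth_take x0 ji) mem_nth // size_takel // ltnW.
case/(nthP x0)=> j; rewrite size_takel ?(ltnW iM) // => ji; rewrite nth_take // => <-.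
have jM := ltn_trans ji iM; case/andP=> /eqP jx uj.
by exists j; rewrite ?mem_iota // ji headE // hit0 // jx eqxx.
Qed.

End Spec.
Lemma RL_lt p : p < T -> RL p < M.
Proof. by case/memT. Qed.

Lemma propagateP s : base s -> va s vI = i -> va s vq = q ->
  let s' := run L propagate s in
  [/\ forall j, j < M -> ar s' 8 j =
        trivial_rule j || has (fun p => (RL p == j) && (ar s' 9 (E p) == 0)) (iota 0 T) :> nat,
      forall y, relevant y -> ar s' 9 y =
        count (fun j => (H j == y) && (ar s' 8 j == 0)) (iota 0 M) + blocked T E RL i q y,
      forall p, p < T -> ar s' 9 (E p) = 0 -> in_closure (E p)
    & forall p, p < T -> ar s' 12 (E p) = 0].
Proof.
move=> bs iE qE; set s1 := run L init s; set s2 := run L start s1.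
rewrite (_ : run L propagate s = run L bfs s2) //.
have b1 : base s1 by apply: base_run bs.
have b2 : base s2 by apply: base_run b1.
have [f1 t1 h1 c1] := initP ML TL RL_lt bs; rewrite -/s1 iE qE in f1 t1 h1 c1.
have [q2 z2 r2] := startP ML TL b1 f1; rewrite -/s2 in q2 z2 r2.
have h2 j : ar s2 8 j = ar s1 8 j by rewrite run_ar.
have c2 y : ar s2 9 y = ar s1 9 y by rewrite run_ar.
have I0 : bfs_inv M T E RL H NX LA (blocked T E RL i q) in_closure 0 (ar s2 8) (ar s2 9) (qs s2).
  have hh j : j < M -> ar s2 8 j = trivial_rule j || has (fun p => RL p == j) (take 0 (qs s2)) :> nat.
    by move=> jM; rewrite h2 h1 // take0 orbF.
  have hc y : relevant y -> ar s2 9 y =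
      count (fun j => (H j == y) && (ar s2 8 j == 0)) (iota 0 M) + blocked T E RL i q y.
    by move=> ry; rewrite c2 c1 //; congr (_ + _); apply: eq_count => j; rewrite h2.
  split=> //; last by move=> p p'; rewrite take0.
  - move=> p pl; have [_ lT _] := q2; have pT := lT p pl; have c0 := z2 p pl.
    split=> //; first by rewrite c2.
    have ry : relevant (E p) by apply: relevantE.
    (* At the start only trivial rules are hit, so soundness is applied with nothing queued. *)
    apply: (inv_sound ML TL in_closure_closed
      (k := 0) (hit := ar s2 8) (cnt := ar s2 9) (l := [::])) => //.
      by move=> j jM; rewrite hh // take0.
    by rewrite -hc // c2.
  - move=> y p _ cy; rewrite LAE => /lo_some[pT ey]; apply: r2 => //.
    by rewrite ey -c2.
have [h3 c3 s3] := bfsP ML TL RL_lt NXE LAE in_closure_closed b2 q2 I0.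
by split=> // p pT; rewrite run_ar // /s2 run_ar // t1.
Qed.

Lemma rule_bodyP s : base s -> va s vI = i -> 2 <= va s vO ->
  let s' := run L rule_body s in
  let l := if emits R (take i rs) x then [:: emitted R x] else [::] in
  [/\ outs s' = outs s ++ flatten (map (@enc_rule n) l), 2 <= va s' vO &
    va s' vC = va s vC + size l].
Proof.
move=> bs iE O2; set s1 := run L (Assign vq (Get 5 (V vI))) s.
set s2 := run L propagate s1; set s3 := run L verdict s2; set s4 := run L tally_unhit s3.
set s5 := run L check s4; rewrite (_ : run L rule_body s = run L (IfN (V vok) emit) s5) //.
have b1 : base s1 by apply: base_run bs.
have b2 : base s2 by apply: base_run b1.
have b3 : base s3 by apply: base_run b2.
have b4 : base s4 by apply: base_run b3.
have b5 : base s5 by apply: base_run b4.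
have q1 : va s1 vq = q.
  case: bs => _ [_ _ e5 _ _].
  by rewrite /s1 /= /idx /= (_ : va s 2 = i) // e5 headE.
have [h2 c2 d2 t2] := propagateP b1 iE q1; rewrite -/s2 in h2 c2 d2 t2.
have [i2 q2] : va s2 vI = i /\ va s2 vq = q by split; rewrite /s2 run_va.
have v3 := verdictP ML TL b2; rewrite -/s3 i2 q2 in v3.
have [i3 q3] : va s3 vI = i /\ va s3 vq = q by split; rewrite /s3 run_va.
have t4 := tally_unhitP TL b3; rewrite -/s4 q3 in t4.
have [i4 q4] : va s4 vI = i /\ va s4 vq = q by split; rewrite /s4 run_va.
have ok4 : va s4 vok = va s3 vok by rewrite /s4 run_va.
rewrite {}v3 in ok4.
have a9 y : ar s4 9 y = ar s2 9 y by rewrite /s4 run_ar // /s3 run_ar.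
have a8 j : ar s3 8 j = ar s2 8 j by rewrite /s3 run_ar.
have ok5 := checkP TL b4 ok4; rewrite -/s5 i4 q4 in ok5.
have a95 y : ar s5 9 y = ar s2 9 y by rewrite /s5 run_ar.
have [i5 q5] : va s5 vI = i /\ va s5 vq = q by split; rewrite /s5 run_va.
have okE : va s5 vok = emits R (take i rs) x.
  rewrite ok5 (hit0 h2 c2 d2 iM) -/x /emits; case: (boolP (unhit W (rule_of x))) => /= [ux|ux].
    rewrite (first_emits h2 c2 d2) andbC; congr (nat_of_bool (_ && _)).
    rewrite -(check_yields h2 c2 d2 ux); apply: eq_in_all => p.
    rewrite mem_iota => /andP[_ pT]; rewrite !a9 t4; congr (_ ==> (_ + _ == _)).
    rewrite /s3 run_ar // t2 // add0n.
    by apply: eq_count => p'; rewrite a8.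
  by rewrite /yields -/(closure_of R x) -/W (negbTE ux) andbF.
have O5 : va s5 vO = va s vO.
  by rewrite /s5 run_va // /s4 run_va // /s3 run_va // /s2 run_va.
have C5 : va s5 vC = va s vC.
  by rewrite /s5 run_va // /s4 run_va // /s3 run_va // /s2 run_va.
have o5 : outs s5 = outs s.
  rewrite /outs O5; apply: eq_map => k.
  by rewrite /s5 run_ar // /s4 run_ar // /s3 run_ar // /s2 run_ar.
cbv zeta; rewrite run_IfN [eval _ _ _]/= okE; case: ifP => em.
  by case: (emits _ _ _) em => //= _; rewrite cats0 addn0 o5 O5 C5.
have {em} em : emits R (take i rs) x by case: (emits _ _ _) em.
have [|oE OE CE] := emitP ML TL b5; first by rewrite O5.
rewrite em oE OE CE o5 C5 /= cats0 addn1; split=> //.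
congr (_ ++ _); rewrite i5 q5 /tails_of.
have ux : unhit W (rule_of x) by case/andP: em => /and3P[].
rewrite (eq_filter (a2 := fun p => (RL p == i) && (ar s2 9 (E p) == 1))); last first.
  by move=> p; rewrite a95.
rewrite (filterT (fun e => ar s2 9 e == 1)) // (tails_filter h2 c2 d2 ux).
by rewrite /enc_rule size_map.
Qed.

End OneRule.
End Rules.

(** * The algorithm *)

(** The number of rules is stored twice: at index 1 of the output, and in array 2 at the index given
    by the output length, where the epilogue looks for it. The loop then overwrites the input from
    cell 48 on: index [vP - 47] of array 16 is cell [vP + 1]. *)
Definition finish :=
  Seq (Put 1 (N 1) (V vC))
  (Seq (Put 2 (N 0) (Minus (V vO) (N 1)))
  (Seq (Put 2 (Minus (V vO) (N 1)) (V vC))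
  (Loop vP (IfN (Minus (V vP) (N 46))
     (Put 16 (Minus (V vP) (N 47)) (Get 1 (Plus (V vP) (N 1)))))))).

Definition main :=
  Seq norm (Seq parse (Seq chain (Seq (Assign vO (N 2)) (Seq (Assign vC (N 0))
  (Seq (For vI vM rule_body) finish))))).

Lemma finishP L s : 2 <= va s vO -> let s' := run L finish s in
  [/\ ar s' 2 0 = va s vO - 1, ar s' 2 (va s vO - 1) = va s vC, ar s' 1 1 = va s vC,
    forall k, 2 <= k -> ar s' 1 k = ar s 1 k
  & forall k, rawb <= k <= L -> ar s' 16 (k - rawb) = ar s' 1 k].
Proof.
move=> O2; pose s1 := run L (Put 2 (Minus (V vO) (N 1)) (V vC))
  (run L (Put 2 (N 0) (Minus (V vO) (N 1))) (run L (Put 1 (N 1) (V vC)) s)).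
pose lp := Loop vP (IfN (Minus (V vP) (N 46))
     (Put 16 (Minus (V vP) (N 47)) (Get 1 (Plus (V vP) (N 1))))).
rewrite (_ : run L finish s = run L lp s1) //.
have a20 : ar s1 2 0 = va s vO - 1 by rewrite /s1 /= /idx /= ifF //; lia.
have a2c : ar s1 2 (va s vO - 1) = va s vC by rewrite /s1 /= /idx /= eqxx.
have a11 : ar s1 1 1 = va s vC by [].
have a1k k : 2 <= k -> ar s1 1 k = ar s 1 k by case: k => [|[|k]].
move: (s1) a20 a2c a11 a1k => {}s1 a20 a2c a11 a1k.
have raw : forall k, rawb <= k <= L -> ar (run L lp s1) 16 (k - rawb) = ar s1 1 k.
  apply: (@run_loop L _ _ s1 (fun i s' =>
    forall k, rawb <= k <= i -> ar s' 16 (k - rawb) = ar s1 1 k)) => // [k|].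
    by rewrite /rawb; lia.
  move=> i s' iL xi sm h k; rewrite /rawb => hk.
  have e1 j : ar s' 1 j = ar s1 1 j by apply: sm.2.
  rewrite run_IfN; have -> : eval L s' (Minus (V vP) (N 46)) = i - 46 by rewrite /= xi.
  case: eqP => [i46|i46]; first by apply: h; rewrite /rawb; lia.
  rewrite /= xi /idx /= e1 /rawb; case: eqP => [ki|ki]; first by congr (ar s1 1); lia.
  by apply: h; rewrite /rawb; lia.
split=> [|||k k2|k hk]; last by rewrite raw // run_ar.
all: rewrite run_ar //; exact: a1k.
Qed.

Lemma run_main L s : run L main s = run L finish (run L (For vI vM rule_body)
  (run L (Assign vC (N 0)) (run L (Assign vO (N 2))
  (run L chain (run L parse (run L norm s)))))).
Proof. by []. Qed.

Section Correct.
Variables (n : nat) (rs : seq (seq 'I_n * 'I_n)).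
Hypothesis wf : wf_rules rs.
Let R := set_of_rules rs.
Let w := enc_input rs.
Let L := size w.

Lemma nat_rulesE : map enc_pair (nat_rules rs) = map (@enc_rule n) rs.
Proof. by rewrite -map_comp; apply: eq_map => x; rewrite /enc_rule /enc_pair /= size_map. Qed.

Lemma pairs_size (G : seq (seq nat * nat)) m : m <= size G ->
  size (pairs G m) <= size (flatten (map enc_pair (take m G))).
Proof.
elim: m => // m IH mG; rewrite /pairs iotaSr map_rcons flatten_rcons size_cat -/(pairs G m).
rewrite (take_nth ([::], 0) mG) map_rcons flatten_rcons size_cat leq_add ?IH 1?ltnW //.
by rewrite size_map add0n /= leqW // leqW.
Qed.

Lemma main_correct : let s := run L main (init_store w) in
  let l := listing R [::] rs in
  [/\ ar s 2 0 = size (enc_rules l), ar s 2 (ar s 2 0) = ar s 1 1,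
    [seq ar s 1 i | i <- iota 1 (ar s 2 0)] = enc_rules l
  & forall k, rawb <= k <= L -> ar s 16 (k - rawb) = ar s 1 k].
Proof.
set s1 := run L norm (init_store w); set s2 := run L parse s1; set s3 := run L chain s2.
set s4 := run L (Assign vC (N 0)) (run L (Assign vO (N 2)) s3).
set s5 := run L (For vI vM rule_body) s4.
rewrite run_main -/s1 -/s2 -/s3 -/s4 -/s5; set G := nat_rules rs; have szG : size G = size rs by rewrite size_map.
have LE : L = (size (size G :: flatten (map enc_pair G))).+1.
  by rewrite nat_rulesE szG.
have i1 k : k < L.-1 -> ar s1 0 k = nth 0 (size G :: flatten (map enc_pair G)) k.
  by move=> kL; rewrite normP // nat_rulesE szG.
have WL : size (size G :: flatten (map enc_pair G)) <= L by rewrite LE.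
have hW k : k < size (size G :: flatten (map enc_pair G)) ->
    ar s1 0 k = nth 0 (size G :: flatten (map enc_pair G)) k.
  by move=> kW; apply: i1; rewrite LE.
have [M2 T2 P2 H2] := parseP WL hW; rewrite -/s2 szG in M2 T2 P2 H2.
set T := size (pairs G (size rs)) in T2.
have TL : T <= L.
  have := @pairs_size G (size rs); rewrite szG leqnn => /(_ isT) h.
  apply: leq_trans h _; rewrite take_oversize ?szG // LE /=; lia.
have ML : size rs <= L.
  rewrite LE /= nat_rulesE; have : size rs <= size (flatten (map (@enc_rule n) rs)).
    by elim: (rs) => //= x l IH; rewrite size_cat; lia.
  by lia.
(* Array 7 lies beyond the input, where memory is initially 0, and nothing has written to it yet; 0
   stands for the empty chain. *)
have z7 y : ar s2 7 y = 0 by rewrite /s2 run_ar // /s1 run_ar.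
have [h6 h7] := chainP (s := s2) (L := L) (ltac:(by rewrite T2)) z7.
rewrite -/s3 T2 in h6 h7.
have b3 : base (size rs) T (ar s2 3) (ar s2 4) (ar s2 5) (ar s3 6) (ar s3 7) s3.
  split; first by split; rewrite /s3 run_va.
  by split=> // p; rewrite /s3 run_ar.
have b4 : base (size rs) T (ar s2 3) (ar s2 4) (ar s2 5) (ar s3 6) (ar s3 7) s4.
  by apply: base_run => //; apply: base_run b3.
have PE : [seq (ar s2 4 p, ar s2 3 p) | p <- iota 0 T] = pairs G (size rs) by rewrite -P2 T2.
have loopP : let l := listing R [::] rs in [/\ outs s5 = flatten (map (@enc_rule n) l),
    2 <= va s5 vO & va s5 vC = size l].
  have M4 : va s4 vM = size rs by case: b4 => -[].
  have := @run_for L vI vM rule_body s4 (fun i s' => let l := listing R [::] (take i rs) in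
   [/\ outs s' = flatten (map (@enc_rule n) l), 2 <= va s' vO & va s' vC = size l]).
  rewrite M4 take_size; apply=> //; first by rewrite take0.
  move=> i s' iM xi sm [oE OE CE].
  have x0 : seq 'I_n * 'I_n by case: (rs) iM => // y.
  have b' := base_same sm isT b4.
  have := rule_bodyP x0 wf ML TL PE H2 h6 h7 iM b' xi OE.
  rewrite (take_nth x0 iM) listing_rcons cat0s; cbv zeta.
  set s6 := run L rule_body s' => -[o6 O6 C6].
  by rewrite o6 oE C6 CE map_cat flatten_cat size_cat.
case: loopP => o5 O5 C5; have [f20 f2c f11 f1 fr] := finishP L O5.
set s := run L finish s5 in f20 f2c f11 f1 fr *.
set l := listing R [::] rs in o5 C5 *.
have szo : va s5 vO = (size (enc_rules l)).+1.
  have : size (outs s5) = va s5 vO - 2 by rewrite size_map size_iota.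
  by rewrite o5 /enc_rules /=; lia.
have e20 : ar s 2 0 = size (enc_rules l) by rewrite f20 szo subn1.
split=> //; first by rewrite f20 f2c f11.
rewrite e20 /enc_rules /= f11 C5; congr (_ :: _).
rewrite -[RHS]o5 /outs szo /enc_rules /= subn2 /=.
by apply: eq_map_iota => k /andP[k2 _]; rewrite f1.
Qed.

Lemma size_enc_rule_sum :
  size (flatten (map (@enc_rule n) rs)) = \sum_(x <- rs) (size x.1 + 2).
Proof.
rewrite size_flatten /shape -map_comp sumnE big_map; apply: eq_bigr => x _.
by rewrite /= size_map addn2.
Qed.

Lemma lsizeE : lsize R = \sum_(x <- rs) (size x.1 + 1).
Proof.
case/andP: wf => /allP us ur; rewrite /lsize.
rewrite (eq_bigl (mem (map (@rule_of n) rs))); last by move=> r; rewrite inE.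
rewrite -big_uniq // big_map big_seq [RHS]big_seq; apply: eq_bigr => x xrs.
by rewrite /= cardsE; move/card_uniqP: (us x xrs) => ->.
Qed.

(** A body of size b takes b + 2 cells, at most twice its share b + 1 of [lsize]; the successor on
    the right pays for the two header cells. *)
Lemma size_input : L.+1 <= 3 * (lsize R).+1.
Proof.
rewrite /L /w /= size_enc_rule_sum lsizeE.
suff: \sum_(x <- rs) (size x.1 + 2) <= 2 * \sum_(x <- rs) (size x.1 + 1) by lia.
by rewrite big_distrr /=; apply: leq_sum => x _; lia.
Qed.

End Correct.

Theorem theorem1p4 :
  exists (p : program) (c : nat),
    forall (n : nat) (rs : seq (seq 'I_n * 'I_n)),
      wf_rules rs ->
      exists t : nat,
        t <= c * (lsize (set_of_rules rs)).+1 ^ 2 /\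
        halts_in p (enc_input rs) t
          (fun o => represents o (critical_rules (Afam (set_of_rules rs)))).
Proof.
have [k hk] := cost_poly main; set k46 := 46.
(* The 9 is the square of the factor 3 in [size_input]; the lengths of prologue and epilogue are
   constants. *)
exists (program_of k46 main), (9 * k + (size (prologue k46) + size (epilogue k46))).
move=> n rs wf; have [e20 e2 eo er] := main_correct wf.
set s := run _ _ _ in e20 e2 eo er; set l := listing _ _ _ in e20 eo.
have oL : ar s 2 0 <= size (enc_input rs).
  rewrite e20 /enc_input /enc_rules /= ltnS leqW //; exact: size_enc_listing.
have o0 : 0 < ar s 2 0 by rewrite e20.
have [|t [ht [hh ho]]] := program_of_correct (erefl k46) (isT : wf_cmd 24 main) oL o0 e2.
  by move=> i /andP[i1 i2]; apply: er; rewrite i1 (leq_trans i2).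
exists t; split.
  apply: leq_trans ht _; have := hk (size (enc_input rs)).
  (* The loop over the rules contains only unnested loops, whence the exponent 2. *)
  have -> : depth main = 2 by [].
  have := size_input wf; set a := (lsize _).+1; set b := size (enc_input rs).
  set e := size _ + size _; set d := cost _ _ => ba db.
  have ba2 : b.+1 ^ 2 <= 9 * a ^ 2 by rewrite -[9]/(3 ^ 2) -expnMn leq_exp2r.
  rewrite mulnDl leq_add ?leq_pmulr ?expn_gt0 //; apply: leq_trans db _.
  by rewrite [9 * k]mulnC -mulnA leq_mul2l ba2 orbT.
split=> //; exists l; split.
- by rewrite -ho eo.
- exact: listing_wf.
- exact: listing_critical.
Qed.
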